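(* Let $f:(0,\infty)\to\mathbb{R}$ and let $k\geq 1$ be an integer. If $(-1)^j(x^jf(x))^{(j)}$ is completely monotonic for $j=0,\ldots,k$, then $$f(x)=\int_0^{\infty}e^{-xt}p(t)\,dt,$$ where for some measures $\sigma,\sigma_0,\ldots,\sigma_{k-1}\in\mathcal{A}_0$ we have $t^{k-1}p(t)\in\mathcal{A}_k(\sigma)$, $t^{j}p^{(j)}(t)\in\mathcal{A}_1(\sigma_j)$ for $0\leq j\leq k-1$, and where the measure $$d\sigma_k(t)=t\,d\sigma_{k-1}(t)-(k-1)\sigma_{k-1}([0,t])\,dt$$ is positive. Furthermore, $$(-1)^j(x^jf(x))^{(j)}=\int_0^{\infty}e^{-xt}t^{j}p^{(j)}(t)\,dt\quad\text{for } j\leq k-1,$$ and $$(-1)^k(x^kf(x))^{(k)}=\int_0^{\infty}e^{-xt}\,d\sigma_k(t).$$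
   Context: A function $g:(0,\infty)\to\mathbb{R}$ is completely monotonic if it is infinitely often differentiable on $(0,\infty)$ and $(-1)^ng^{(n)}(x)\geq 0$ for all $n\geq 0$ and all $x>0$. $\mathcal{A}_0$ denotes the set of positive Borel measures $\sigma$ on $[0,\infty)$ such that $\int_0^{\infty}e^{-xs}\,d\sigma(s)<\infty$ for all $x>0$. $\mathcal{A}_1(\sigma)$ denotes the set of functions $t\mapsto\sigma([0,t])$, where $\sigma\in\mathcal{A}_0$. For $n\geq 2$, $\mathcal{A}_n(\sigma)$ denotes the set of $n-2$ times differentiable functions $\xi:[0,\infty)\to\mathbb{R}$ satisfying $\xi^{(j)}(0)=0$ for $j\leq n-2$ and $\xi^{(n-2)}(t)=\int_0^t\sigma([0,s])\,ds$ for some $\sigma\in\mathcal{A}_0$. The measure in parentheses records the measure that occurs: for example, $\xi\in\mathcal{A}_1(\sigma_j)$ means that $\xi(t)=\sigma_j([0,t])$.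
   Formalization: p^(k-1) (k≥2) is read as the right derivative of p^(k-2), shown classical at each t>0 not an atom of σ_(k-1), and t^j p^(j)(t) is 0 at t=0 for j≥1; literally p^(k-1) may not exist at atoms, e.g. k=2, f=e^(-x)/x², p=max(t-1,0). *)

(* Defs.v *)
From mathcomp Require Import all_boot all_order all_algebra.
From mathcomp Require Import all_classical all_reals all_analysis.
Set Implicit Arguments.
Unset Strict Implicit.
Unset Printing Implicit Defensive.
Import Order.TTheory GRing.Theory Num.Theory.
Import numFieldNormedType.Exports.
Local Open Scope classical_set_scope.
Local Open Scope ring_scope.

(* Functions on (0, oo) or [0, oo) are represented by total functions R -> R.
   The definitions below only look at their values on (0, oo), respectively
   [0, oo). *)

Definition completely_monotonic (R : realType) (g : R -> R) : Prop :=
  (forall (n : nat) (x : R), 0 < x -> derivable (derive1n n g) x 1) /\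
  (forall (n : nat) (x : R), 0 < x -> 0 <= (-1) ^+ n * (derive1n n g) x).

(* x |-> (-1)^j (x^j f(x))^(j) *)
Definition signed_derive (R : realType) (j : nat) (f : R -> R) : R -> R :=
  fun x => (-1) ^+ j * derive1n j (fun y : R => y ^+ j * f y) x.

(* A Borel measure on [0, oo) is a Borel measure on R that does not charge
   (-oo, 0). *)
Definition classA0 (R : realType) (sigma : {measure set (measurableTypeR R) -> \bar R}) : Prop :=
  sigma `]-oo, 0[%classic = 0%E /\
  (forall x : R, 0 < x ->
     (\int[sigma]_(s in `[0%R, +oo[) (expR (- (x * s)))%:E < +oo)%E).

Definition classA1 (R : realType) (sigma : {measure set (measurableTypeR R) -> \bar R}) (xi : R -> R)
    : Prop :=
  classA0 sigma /\ (forall t : R, 0 <= t -> (xi t)%:E = sigma `[0, t]%classic).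

Definition derivable_right (R : realType) (g : R -> R) (t : R) : Prop :=
  cvg (h^-1 * (g (t + h) - g t) @[h --> 0^'+]).

Definition derive_right (R : realType) (g : R -> R) (t : R) : R :=
  lim (h^-1 * (g (t + h) - g t) @[h --> 0^'+]).

(* Differentiation on the half-line [0, oo): one-sided at the endpoint. *)
Definition derivable_half (R : realType) (g : R -> R) (t : R) : Prop :=
  if 0 < t then derivable g t 1 else derivable_right g t.

Definition derive_half (R : realType) (g : R -> R) (t : R) : R :=
  if 0 < t then derive1 g t else derive_right g t.

Definition classA (R : realType) (n : nat) (sigma : {measure set (measurableTypeR R) -> \bar R})
    (xi : R -> R) : Prop :=
  match n with
  | 0 => False (* only the classes with n >= 1 consist of functions *)
  | 1 => classA1 sigma xi
  | m.+2 =>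
    [/\ classA0 sigma,
        forall (j : nat) (t : R), (j < m)%N -> 0 <= t ->
          derivable_half (iter j (@derive_half R) xi) t,
        forall j : nat, (j <= m)%N -> iter j (@derive_half R) xi 0 = 0
      & forall t : R, 0 <= t ->
          (iter m (@derive_half R) xi t)%:E =
          (\int[lebesgue_measure]_(s in `[0%R, t]) sigma `[0%R, s]%classic)%E]
  end.

(* p^(j) as the right derivative of the classical derivative p^(j-1); it is the
   classical p^(j) wherever p^(j-1) is differentiable. The right derivative
   is needed at the top order: if t p(t) = int_0^t sigma([0, s]) ds, then p' has
   a jump at every atom t > 0 of sigma, e.g. for p(t) = max(t - 1, 0), which is
   the p of f(x) = exp(-x) / x^2, and sigma([0, t]) is right-continuous.
   At t = 0 and for j >= 1, t^j p^(j)(t) takes the value 0. *)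
Definition deriveR (R : realType) (j : nat) (p : R -> R) : R -> R :=
  if j is i.+1 then derive_right (derive1n i p) else p.

(* Main.v *)
(** Write [h_j(x) = (-1)^j (x^j f(x))^(j)]. Then [- (x h_j)' = h_(j+1) + j h_j],
    so [x h_j] is completely monotonic for [j < k], and Bernstein's theorem gives
    measures with [x h_j = L sigma_j] for [j < k] and [h_k = L sigma_k]. With
    [q_j(t) = sigma_j([0, t])] this reads [h_j = L(q_j dt)], and uniqueness of
    Laplace transforms turns the identity for [- (x h_j)'] into
    [t dsigma_j = q_(j+1) dt + j q_j dt] for [j < k - 1] and
    [t dsigma_(k-1) = dsigma_k + (k-1) q_(k-1) dt]. The former integrates to
    [t q_j(t) = int_0^t (q_(j+1) + (j+1) q_j)], whence [q_j = t^j p^(j)] for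
    [p = q_0] by induction, and [(t^(k-1) p)^(j)] is [t^(k-1-j)] times a
    combination of [q_0, ..., q_j] with natural coefficients.

    Bernstein's theorem is proved as in Feller: the Taylor expansion of [g] at [l]
    says that the measure with mass [(-l)^n g^(n)(l) / n!] at [n / l] has Laplace
    transform [g (l (1 - exp (- x / l)))], and Helly's selection theorem provides a
    limit as [l] tends to infinity. *)

Require Import Defs.
From HB Require Import structures.
From mathcomp Require Import all_boot all_order all_algebra.
From mathcomp Require Import all_classical all_reals all_analysis.
From mathcomp Require Import measurable_realfun.
From mathcomp Require Import ring lra zify.
Set Implicit Arguments.
Unset Strict Implicit.
Unset Printing Implicit Defensive.
Import Order.TTheory GRing.Theory Num.Theory.
Import numFieldNormedType.Exports.
Local Open Scope classical_set_scope.
Local Open Scope ring_scope.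

Local Notation "f ^` ()" := (derive1 f) : ring_scope.
Local Notation "f ^` ( n )" := (derive1n n f) : ring_scope.

(** * Completely monotonic functions *)

Section derivatives_on_the_half_line.
Context {R : realType}.
Implicit Types (f g u : R -> R) (x : R).

(** Multiplication by x trades a measure for a density: x L(q dt) = L(dsigma) when q(t) =
    sigma([0, t]). So each h_j with j < k acquires a nondecreasing density, whereas h_k is only
    known to be the transform of a measure. Hence sigma_k is positive from the outset, and q_(k-1)
    may jump, while q_j with j < k - 1 is continuous on (0, oo) because t q_j is an integral of a
    locally bounded function. Derivatives of such integrals come from monotonicity of the integrand,
    which squeezes difference quotients.

    Total masses may be infinite, so nothing is subtracted before it is known to be finite.
    Uniqueness is therefore an equality between one weighted measure and a sum of two. It rests on
    the integrals of e^(-y t) (1 - e^(-x t))^N, which the transform determines and which, for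
    suitable x and N, tend to the integral of e^(-y t) over t > T.

    In Bernstein's theorem only distribution functions are made to converge, pointwise; a measure
    enters once the limit is known. *)

Definition smooth_pos g :=
  forall (n : nat) x, 0 < x -> derivable (derive1n n g) x 1.

Lemma near_eq_pos f g x : (forall y, 0 < y -> f y = g y) -> 0 < x ->
  \forall y \near x, f y = g y.
Proof.
move=> fg x0; near=> y; apply: fg.
near: y; exact: lt_nbhsr.
Unshelve. all: by end_near. Qed.

Lemma derivable_is_derive1 f x : derivable f x 1 -> is_derive x 1 f (f^`() x).
Proof. by move=> df; rewrite derive1E; exact: derivableP. Qed.

Lemma is_derive_derive1 f x (d : R) : is_derive x 1 f d -> f^`() x = d.
Proof. by move=> df; rewrite derive1E derive_val. Qed.

Lemma derive1_eq_pos f g x : (forall y, 0 < y -> f y = g y) -> 0 < x ->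
  f^`() x = g^`() x.
Proof.
by move=> fg x0; rewrite !derive1E; apply: near_eq_derive; exact: near_eq_pos.
Qed.

Lemma derivable_eq_pos f g x : (forall y, 0 < y -> f y = g y) -> 0 < x ->
  derivable f x 1 -> derivable g x 1.
Proof. by move=> fg x0; apply: near_eq_derivable; exact: near_eq_pos. Qed.

Lemma derive1n_eq_pos n f g : (forall y, 0 < y -> f y = g y) ->
  forall y, 0 < y -> f^`(n) y = g^`(n) y.
Proof.
move=> fg; elim: n => [|n IH] y y0; first exact: fg.
rewrite !derive1nS; exact: derive1_eq_pos.
Qed.

Lemma smooth_eq_pos f g : (forall y, 0 < y -> f y = g y) ->
  smooth_pos f -> smooth_pos g.
Proof.
move=> fg sf n x x0; apply: derivable_eq_pos (sf n x x0) => // y y0.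
exact: derive1n_eq_pos.
Qed.

Lemma smooth_derive1n g m : smooth_pos g -> smooth_pos (g^`(m)).
Proof. by move=> sg n x x0; rewrite /derive1n -iterD; exact: sg. Qed.

Lemma smooth_pos_derive1 f : (forall x, 0 < x -> derivable f x 1) ->
  smooth_pos f^`() -> smooth_pos f.
Proof. by move=> df sf [//|n] x x0; rewrite derive1Sn; apply: sf. Qed.

Lemma derive1nD f g : smooth_pos f -> smooth_pos g ->
  smooth_pos (fun y => f y + g y) /\
  forall n x, 0 < x -> (fun y => f y + g y)^`(n) x = f^`(n) x + g^`(n) x.
Proof.
move=> sf sg.
have E n x : 0 < x -> (fun y => f y + g y)^`(n) x = f^`(n) x + g^`(n) x.
  elim: n x => // n IH x x0; rewrite !derive1nS (derive1_eq_pos IH)//.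
  have := derivable_is_derive1 (sf n x x0).
  have := derivable_is_derive1 (sg n x x0) => dg df.
  by apply: is_derive_derive1.
split; last exact: E.
move=> n x x0.
apply: (@derivable_eq_pos (f^`(n) + g^`(n))) => //; last first.
  by apply: derivableD; [exact: sf|exact: sg].
by move=> y y0; rewrite E.
Qed.

Lemma derive1nZ c f : smooth_pos f ->
  smooth_pos (fun y => c * f y) /\
  forall n x, 0 < x -> (fun y => c * f y)^`(n) x = c * f^`(n) x.
Proof.
move=> sf.
have E n x : 0 < x -> (fun y => c * f y)^`(n) x = c * f^`(n) x.
  elim: n x => // n IH x x0; rewrite !derive1nS (derive1_eq_pos IH)//.
  have df := derivable_is_derive1 (sf n x x0).
  by apply: is_derive_derive1; apply: is_deriveZ.
split; last exact: E.
move=> n x x0.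
apply: (@derivable_eq_pos (c *: f^`(n))) => //; last first.
  by apply: derivableZ; exact: sf.
by move=> y y0; rewrite E.
Qed.

(** Leibniz's rule stops after two terms because the factor is linear. At n = 0 the index [n.-1] is
    a default value, multiplied by 0. *)
Lemma derive1nX f : smooth_pos f ->
  smooth_pos (fun y => y * f y) /\
  forall n x, 0 < x ->
    (fun y => y * f y)^`(n) x = x * f^`(n) x + n%:R * f^`(n.-1) x.
Proof.
move=> sf.
have D n x : 0 < x ->
    is_derive x 1 (fun y => y * f^`(n) y + n%:R * f^`(n.-1) y)
      (x * f^`(n.+1) x + n.+1%:R * f^`(n) x).
  move=> x0.
  have df := derivable_is_derive1 (sf n x x0).
  have dg := derivable_is_derive1 (sf n.-1 x x0).
  apply: is_derive_eq.
  rewrite /= -derive1nS.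
  case: n {df dg} => [|n] /=; rewrite -?derive1nS !scaler1 /GRing.scale /=;
    rewrite -?natr1; ring.
have E n x : 0 < x ->
    (fun y => y * f y)^`(n) x = x * f^`(n) x + n%:R * f^`(n.-1) x.
  elim: n x => [|n IH] x x0; first by rewrite mul0r addr0.
  by rewrite derive1nS (derive1_eq_pos IH)//; apply: is_derive_derive1; exact: D.
split; last exact: E.
move=> n x x0.
have [dD _] := D n x x0.
by apply: derivable_eq_pos dD => // y y0; rewrite E.
Qed.

Lemma smoothXn j f : smooth_pos f -> smooth_pos (fun y => y ^+ j * f y).
Proof.
move=> sf; elim: j => [|j IH].
  by apply: smooth_eq_pos sf => y _; rewrite expr0 mul1r.
have [s _] := derive1nX IH.
by apply: smooth_eq_pos s => y _; rewrite exprS mulrA.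
Qed.

Lemma smooth_signed_derive j f : smooth_pos f -> smooth_pos (signed_derive j f).
Proof.
move=> sf; have [+ _] := derive1nZ ((-1) ^+ j) (smooth_derive1n (m := j) (smoothXn (j := j) sf)).
by apply: smooth_eq_pos.
Qed.

(** Leibniz's rule for x^(j+1) f = x (x^j f), differentiated j + 1 times. *)
Lemma signed_deriveS j f x : smooth_pos f -> 0 < x ->
  signed_derive j.+1 f x =
    - (x * (signed_derive j f)^`() x + j.+1%:R * signed_derive j f x).
Proof.
move=> sf x0; rewrite /signed_derive.
have [_ E] := derive1nX (smoothXn (j := j) sf).
have -> : (fun y => y ^+ j.+1 * f y) = (fun y => y * (y ^+ j * f y)).
  by apply/funext => y; rewrite exprS mulrA.
rewrite E//=.
have [_ /(_ 1%N x x0)] := derive1nZ ((-1) ^+ j) (smooth_derive1n (m := j) (smoothXn (j := j) sf)).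
rewrite derive1n1 => ->; rewrite derive1n1 -derive1nS exprS; ring.
Qed.

End derivatives_on_the_half_line.

Section completely_monotonic_functions.
Context {R : realType}.
Implicit Types (f g : R -> R).

Lemma cm_eq_pos f g : (forall y, 0 < y -> f y = g y) ->
  completely_monotonic f -> completely_monotonic g.
Proof.
move=> fg [sf pf]; split; first exact: smooth_eq_pos fg sf.
by move=> n x x0; rewrite -(derive1n_eq_pos n fg)//; exact: pf.
Qed.

Lemma cmD f g : completely_monotonic f -> completely_monotonic g ->
  completely_monotonic (fun y => f y + g y).
Proof.
move=> [sf pf] [sg pg]; have [s E] := derive1nD sf sg.
split; first exact: s.
move=> n x x0; rewrite E// mulrDr addr_ge0//; [exact: pf|exact: pg].
Qed.

Lemma cmZ (c : R) f : 0 <= c -> completely_monotonic f ->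
  completely_monotonic (fun y => c * f y).
Proof.
move=> c0 [sf pf]; have [s E] := derive1nZ c sf.
split; first exact: s.
move=> n x x0; rewrite E// mulrCA mulr_ge0//; exact: pf.
Qed.

(** The sign condition of order n + 1 for f is that of order n for -f', so only order 0 has to be
    supplied. *)
Lemma cm_opp_derive1 f : (forall x, 0 < x -> 0 <= f x) ->
  (forall x, 0 < x -> derivable f x 1) ->
  completely_monotonic (fun y => - f^`() y) -> completely_monotonic f.
Proof.
move=> f0 df cf.
have [sf pf] := cf; have [s E] := derive1nZ (-1) sf.
have s' : smooth_pos f^`().
  by apply: smooth_eq_pos s => y _; rewrite mulN1r opprK.
have [_ E'] := derive1nZ (-1) s'.
split; first exact: smooth_pos_derive1.
case=> [|n] x x0; first by rewrite expr0 mul1r; exact: f0.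
rewrite derive1Sn; have := pf n x x0.
have -> : (fun y => - f^`() y) = (fun y => -1 * f^`() y).
  by apply/funext => y; rewrite mulN1r.
by rewrite E'// exprS mulrCA -mulrA.
Qed.

Lemma cm_mulX_signed_derive j f : smooth_pos f ->
  completely_monotonic (signed_derive j f) ->
  completely_monotonic (signed_derive j.+1 f) ->
  (forall x, 0 < x -> (fun y => y * signed_derive j f y)^`() x =
     - (signed_derive j.+1 f x + j%:R * signed_derive j f x)) /\
  completely_monotonic (fun y => y * signed_derive j f y).
Proof.
move=> sf cj cj1.
have [s E] := derive1nX (smooth_signed_derive (j := j) sf).
have D x : 0 < x -> (fun y => y * signed_derive j f y)^`() x =
     - (signed_derive j.+1 f x + j%:R * signed_derive j f x).
  move=> x0; have := E 1%N x x0; rewrite !derive1n1 => ->.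
  rewrite signed_deriveS// -natr1 /=; ring.
split=> //; apply: cm_opp_derive1.
- move=> x x0; rewrite mulr_ge0//; first exact: ltW.
  by have [_ /(_ 0%N x x0)] := cj; rewrite expr0 mul1r.
- by move=> x x0; exact: (s 0%N x x0).
- apply: cm_eq_pos (cmD cj1 (cmZ (ler0n R j) cj)).
  by move=> y y0; rewrite D// opprK.
Qed.

End completely_monotonic_functions.

(** * Taylor series *)

Section taylor_series.
Context {R : realType}.

Lemma is_derive_ge0_le (f df : R -> R) (a b : R) : a <= b ->
  (forall x, a <= x <= b -> is_derive x 1 f (df x)) ->
  (forall x, a < x < b -> 0 <= df x) -> f a <= f b.
Proof.
move=> ab dfE df0.
have I x : x \in `]a, b[ -> a <= x <= b.
  by rewrite in_itv/= => /andP[/ltW-> /ltW->].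
apply: (@ger0_derive1_ndecr _ f a b) => //.
- by move=> x /I /dfE [].
- move=> x xab; rewrite (is_derive_derive1 (dfE _ (I _ xab))).
  by apply: df0; move: xab; rewrite in_itv.
- apply: derivable_within_continuous => x; rewrite in_itv/=.
  by move=> /dfE [].
Qed.

Lemma is_derive_Xn n (x : R) :
  is_derive x 1 (fun y : R => y ^+ n) (n%:R * x ^+ n.-1).
Proof.
have := is_deriveX n (is_derive_id x (1 : R)).
by rewrite exprfctE /GRing.scale /= mulr1.
Qed.

Lemma is_deriveZ_fun (f : R -> R) (x c d : R) : is_derive x 1 f d ->
  is_derive x 1 (fun y => c * f y) (c * d).
Proof. exact: is_deriveZ. Qed.

Definition taylor_sum (c : nat -> R) (n : nat) (u : R) : R :=
  \sum_(i < n) c i * (u ^+ i / i`!%:R).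

Lemma is_derive_taylor_sum (c : nat -> R) n (u : R) :
  is_derive u 1 (taylor_sum c n) (taylor_sum (fun i => c i.+1) n.-1 u).
Proof.
elim: n => [|n IH].
  have -> : taylor_sum c 0 = cst 0.
    by apply/funext => x; rewrite /taylor_sum big_ord0.
  by rewrite /taylor_sum big_ord0; exact: is_derive_cst.
have -> : taylor_sum c n.+1 =
    taylor_sum c n + (fun x => c n * (x ^+ n / n`!%:R)).
  by apply/funext => x; rewrite /taylor_sum big_ord_recr.
have D : is_derive u 1 (fun x : R => c n * (x ^+ n / n`!%:R))
    (c n * (n%:R * u ^+ n.-1 / n`!%:R)).
  have := is_deriveZ_fun (c n / n`!%:R) (is_derive_Xn n u).
  rewrite (_ : (fun x => _) = (fun x => c n * (x ^+ n / n`!%:R))); last first.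
    by apply/funext => x; rewrite mulrAC mulrA.
  by move/is_derive_eq; apply; rewrite mulrAC mulrA.
apply: is_derive_eq; case: n {IH D} => [|n] /=.
  by rewrite /taylor_sum big_ord0 !mul0r mulr0 addr0.
rewrite /taylor_sum big_ord_recr /=; congr (_ + _ * _).
rewrite factS natrM; field.
by rewrite nat1r !pnatr_eq0 -lt0n fact_gt0.
Qed.

Section absolutely_monotonic.
Variables (l : R) (phi : nat -> R -> R).
Hypothesis phi_derive : forall n (u : R), 0 <= u < l ->
  is_derive u 1 (phi n) (phi n.+1 u).
Hypothesis phi_ge0 : forall n (u : R), 0 <= u < l -> 0 <= phi n u.

(* [rem n k] is the Taylor remainder of order [n] of [phi k] at 0; its derivative
   is [rem n.-1 k.+1], also for [n = 0]. *)
Let rem n k u := phi k u - taylor_sum (fun i => phi (k + i)%N 0) n u.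

Let rem_derive n k (u : R) : 0 <= u < l ->
  is_derive u 1 (rem n k) (rem n.-1 k.+1 u).
Proof.
move=> ul; have d1 := phi_derive k ul.
have d2 := is_derive_taylor_sum (fun i => phi (k + i)%N 0) n u.
apply: (is_derive_eq (is_deriveB d1 d2)).
by rewrite /rem; congr (_ - taylor_sum _ _ _); apply/funext => i; rewrite addnS.
Qed.

Let rem0 n k : 0 < l -> rem n.+1 k 0 = 0.
Proof.
move=> l0; rewrite /rem /taylor_sum big_ord_recl big1 /=.
  by rewrite addn0 expr0 divr1 mulr1 addr0 subrr.
by move=> i _; rewrite /= exprS mul0r mul0r mulr0.
Qed.

(* The second inequality says that [rem n k u / u ^ n] is nondecreasing in [u],
   which is what makes the remainder tend to 0. *)
Let rem_ge0 n k (u : R) : 0 <= u < l ->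
  0 <= rem n k u /\ n%:R * rem n k u <= u * rem n.-1 k.+1 u.
Proof.
elim: n k u => [|n IH] k u ul.
  rewrite /rem /taylor_sum !big_ord0 !subr0 mul0r; split; first exact: phi_ge0.
  by rewrite mulr_ge0 ?phi_ge0//; case/andP: ul.
have [u0 ul'] := andP ul.
have l0 : 0 < l := le_lt_trans u0 ul'.
have le x : 0 <= x <= u -> 0 <= x < l.
  by move=> /andP[-> xu] /=; exact: le_lt_trans ul'.
split.
  rewrite -(rem0 n k l0); apply: (is_derive_ge0_le (df := rem n k.+1)) => //.
    by move=> x /le; exact: rem_derive.
  by move=> x /andP[/ltW x0 /ltW xu]; apply: (IH _ _ _).1; rewrite le// x0 xu.
rewrite -subr_ge0 /=.
pose D x := x * rem n k.+1 x - n.+1%:R * rem n.+1 k x.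
have D0 : D 0 = 0 by rewrite /D mul0r rem0// mulr0 subr0.
rewrite -[leLHS]D0 -/(D u).
apply: (is_derive_ge0_le
  (df := fun x => x * rem n.-1 k.+2 x - n%:R * rem n k.+1 x)) => //.
  move=> x /le xl; have d1 := rem_derive n k.+1 xl.
  have d2 := rem_derive n.+1 k xl.
  apply: is_derive_eq; rewrite /GRing.scale /= -natr1; ring.
move=> x /andP[/ltW x0 /ltW xu]; rewrite subr_ge0.
by apply: (IH _ _ _).2; rewrite le// x0 xu.
Qed.

Let rem_ratio n (u v : R) : 0 < u -> u <= v -> v < l ->
  rem n 0 u / u ^+ n <= rem n 0 v / v ^+ n.
Proof.
move=> u0 uv vl.
have le x : u <= x <= v -> 0 < x /\ 0 <= x < l.
  move=> /andP[ux xv]; have x0 := lt_le_trans u0 ux.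
  by rewrite x0 ltW//=; split=> //; exact: le_lt_trans vl.
apply: (is_derive_ge0_le (f := fun x => rem n 0 x / x ^+ n) (df := fun x =>
   (x * rem n.-1 1%N x - n%:R * rem n 0 x) / x ^+ n.+1)) => //.
  move=> x /le[x0 xl]; have d1 := rem_derive n 0 xl.
  have xn0 : x ^+ n != 0 by rewrite expf_neq0// gt_eqF.
  have d3 := is_deriveV (f := fun y : R => y ^+ n) xn0 (is_derive_Xn n x).
  apply: (is_derive_eq (is_deriveM d1 d3)).
  rewrite /GRing.scale /=; case: n {d1 d3} xn0 => [|n] xn0.
    by rewrite /= !expr0 expr1; field; rewrite gt_eqF.
  have y0 : x ^+ n != 0 by rewrite expf_neq0// gt_eqF.
  rewrite /= (exprS x n.+1) !(exprS x n) -[n.+1%:R * rem _ _ _]mulrC.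
  move: (x ^+ n) y0 (n.+1%:R : R) => y y0 c.
  by field; rewrite y0 gt_eqF.
move=> x /andP[/ltW x1 /ltW x2].
have /le[x0 xl] : u <= x <= v by rewrite x1.
apply: divr_ge0; last by rewrite exprn_ge0// ltW.
rewrite subr_ge0; exact: (rem_ge0 n 0 xl).2.
Qed.

Lemma absolutely_monotonic_taylor (u : R) : 0 <= u < l ->
  (taylor_sum (phi ^~ 0) n u @[n --> \oo] --> phi 0 u).
Proof.
move=> ul; have [u0 ul'] := andP ul; have l0 : 0 < l := le_lt_trans u0 ul'.
have [->|un0] := eqVneq u 0.
  apply: cvg_near_cst; apply: filterS (nbhs_infty_gt 0) => -[//|n] _.
  by apply/esym/eqP; rewrite -subr_eq0; apply/eqP; exact: rem0.
have {}u0 : 0 < u by rewrite lt_def un0.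
(* A point strictly between u and l: monotonicity of rem / u^n bounds the remainder at u by phi_0(v)
   (u / v)^n, which is geometric with u / v < 1. *)
pose v := (u + l) / 2.
have uv : u < v by rewrite /v; lra.
have vl : v < l by rewrite /v; lra.
have v0 : 0 < v := lt_trans u0 uv.
have r0 : rem n 0 u @[n --> \oo] --> 0.
  apply: (@squeeze_cvgr _ _ _ _ (cst 0) (fun n => phi 0 v * (u / v) ^+ n)).
  - near=> n; rewrite (rem_ge0 n 0 ul).1/=.
    have := rem_ratio n u0 (ltW uv) vl.
    rewrite ler_pdivrMr ?exprn_gt0// => /le_trans; apply.
    rewrite [leLHS](_ : _ = rem n 0 v * (u / v) ^+ n); last first.
      by rewrite (expr_div_n u v) -mulrA; congr (_ * _); exact: mulrC.
    apply: ler_wpM2r; first by rewrite exprn_ge0// divr_ge0// ltW.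
    rewrite /rem gerBl; apply: sumr_ge0 => i _.
    by rewrite mulr_ge0 ?phi_ge0 ?lexx// divr_ge0// exprn_ge0// ltW.
  - exact: cvg_cst.
  - apply: cvg_geometric; rewrite ger0_norm ?ltr_pdivrMr ?mul1r//.
    by apply: divr_ge0; exact: ltW.
rewrite (_ : (fun n => taylor_sum (phi ^~ 0) n u) =
    (fun n => phi 0 u - rem n 0 u)); last first.
  by apply/funext => n; rewrite /rem opprB addrC subrK.
by rewrite -[X in _ --> X]subr0; apply: cvgB => //; exact: cvg_cst.
Unshelve. all: by end_near. Qed.
End absolutely_monotonic.

(** The reflection u |-> g(l - u) turns alternating signs into nonnegative derivatives on [0, l),
    and u = l - x ranges over all of [0, l) as x ranges over (0, l]. *)
Lemma cm_taylor (g : R -> R) (l x : R) : completely_monotonic g ->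
  0 < x <= l ->
  taylor_sum (fun n => (-1) ^+ n * g^`(n) l) n (l - x) @[n --> \oo] --> g x.
Proof.
move=> [sg pg] /andP[x0 xl].
pose phi n u := (-1) ^+ n * g^`(n) (l - u).
have -> : (fun n => (-1) ^+ n * g^`(n) l) = phi ^~ 0.
  by apply/funext => n; rewrite /phi subr0.
have -> : g x = phi 0%N (l - x) by rewrite /phi expr0 mul1r opprB addrC subrK.
apply: (@absolutely_monotonic_taylor l).
- move=> n u /andP[u0 ul].
  have lu : 0 < l - u by rewrite subr_gt0.
  have d1 : is_derive (l - u) 1 g^`(n) (g^`(n.+1) (l - u)).
    by rewrite derive1nS; apply: derivable_is_derive1; exact: sg.
  have d2 : is_derive u 1 (fun v : R => l - v) (- 1).
    have := is_deriveB (is_derive_cst l u (1 : R)) (is_derive_id u (1 : R)).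
    by rewrite sub0r.
  have : is_derive u 1 (phi n) ((-1) ^+ n * (g^`(n.+1) (l - u) * -1)).
    have d3 := @is_derive1_comp _ g^`(n) (fun v => l - v) u _ _ d1 d2.
    have d4 := is_deriveZ_fun ((-1) ^+ n) d3.
    exact: d4.
  move/is_derive_eq; apply.
  by rewrite /phi exprS mulrN1 mulN1r mulrN mulNr.
- by move=> n u /andP[_ ul]; apply: pg; rewrite subr_gt0.
- by rewrite subr_ge0 xl ltrBlDr ltrDl.
Qed.

End taylor_series.

(** * Helly's selection theorem *)

Section helly_selection.
Context {R : realType}.

(** Tychonoff's theorem replaces the diagonal argument: the sequence has a cluster point G in a
    product of segments. A neighbourhood of G controls finitely many coordinates, here those with
    [pickle i <= M], up to 1 / (M + 1), and some index beyond M lies in it. The selection need not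
    increase; [n <= phi n] is enough for limits. *)
Lemma countable_subsequence (I : countType) (u : nat -> I -> R) (B : I -> R) :
  (forall n i, 0 <= u n i <= B i) ->
  exists (phi : nat -> nat) (G : I -> R), (forall n, (n <= phi n)%N) /\
    forall i, u (phi n) i @[n --> \oo] --> G i.
Proof.
move=> uB.
have K := @tychonoff I (fun=> R) (fun i => `[0, B i]%classic)
  (fun i => @segment_compact R 0 (B i)).
have [|G [_ clG]] := K (u @ \oo) (fmap_proper_filter u eventually_filter).
  by exists 0%N => // n _ i; rewrite /= in_itv/=; exact: uB.
have FG : Filter (nbhs (G : prod_topology (fun _ : I => R))).
  exact: nbhs_filter.
have near_G (M : nat) : nbhs (G : prod_topology (fun _ : I => R))
    [set g | forall i, (pickle i <= M)%N -> `|G i - g i| < M.+1%:R^-1].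
  have near_k (k : nat) : nbhs (G : prod_topology (fun _ : I => R))
      [set g | forall i, pickle i = k -> `|G i - g i| < M.+1%:R^-1].
    have [[i ik]|nk] := pselect (exists i : I, pickle i = k); last first.
      by apply: filterE => g i ik; exfalso; apply: nk; exists i.
    have /cvgrPdist_lt/(_ M.+1%:R^-1) := @proj_continuous I (fun=> R) i G.
    rewrite invr_gt0 ltr0Sn => /(_ isT); apply: filterS => g Gg j jk.
    by have -> : j = i by apply: (pcan_inj pickleK); rewrite jk ik.
  have := @filter_forall _ 'I_M.+1 (fun k => [set g | forall i, pickle i = k ->
    `|G i - g i| < M.+1%:R^-1]) _ FG (fun k => near_k k).
  apply: filterS => g Gg i iM.
  exact: (Gg (Ordinal (iM : (pickle i < M.+1)%N))).
have ex M : exists n, (M <= n)%N /\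
    forall i, (pickle i <= M)%N -> `|G i - u n i| < M.+1%:R^-1.
  have [|g [[n Mn <-] Gg]] := clG [set u n | n in [set n | (M <= n)%N]] _ _ (near_G M).
    by exists M => // n Mn; exists n.
  by exists n.
have [phi phiP] := choice ex.
exists phi, G; split=> [n|i]; first exact: (phiP n).1.
apply/cvgrPdist_lt => e e0; near=> n.
apply: lt_trans ((phiP n).2 i _) _.
  by near: n; exact: nbhs_infty_ge.
near: n; exact: near_infty_natSinv_lt (PosNum e0).
Unshelve. all: by end_near. Qed.

(** Convergence is arranged at the rationals only. At a continuity point of the right-continuous
    regularization H, monotonicity squeezes F between its values at rationals on either side. *)
Lemma helly (F : nat -> R -> R) (B : R -> R) :
  (forall n, {homo F n : s t / s <= t}) -> (forall n t, 0 <= F n t <= B t) ->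
  exists (phi : nat -> nat) (H : R -> R),
  [/\ forall n, (n <= phi n)%N, {homo H : s t / s <= t},
      (forall t, H x @[x --> t^'+] --> H t),
      (forall t, (forall s, s < t -> forall n, F n s = 0) -> 
         forall s, s < t -> H s = 0) /\ (forall t, 0 <= H t) &
      forall t, {for t, continuous H} -> F (phi n) t @[n --> \oo] --> H t].
Proof.
move=> ndF FB.
have [phi [G [phin FG]]] :=
  @countable_subsequence rat (fun n q => F n (ratr q)) (fun q => B (ratr q))
  (fun n q => FB n (ratr q)).
have ndG p q : ratr p <= ratr q :> R -> G p <= G q.
  move=> pq; apply: (ler_cvg_to (FG p) (FG q)).
  by apply: nearW => n; exact: ndF.
have G0 q : 0 <= G q.
  apply: (ler_cvg_to (cvg_cst 0) (FG q)).
  by apply: nearW => n; case/andP: (FB (phi n) (ratr q)).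
(* The strict inequality makes the infimum right-continuous; at a rational t it may differ from
   G. *)
pose S (t : R) := [set G q | q in [set q : rat | t < ratr q]].
pose H (t : R) := inf (S t).
have S0 t : S t !=set0.
  have /rat_in_itvoo[q /itvP qt] : t < t + 1 by rewrite ltrDl.
  by exists (G q), q => //=; rewrite qt.
have Slb t : has_lbound (S t) by exists 0 => _ [q _ <-].
have HG t q : t < ratr q -> H t <= G q.
  by move=> tq; apply: ge_inf => //; exists q.
have GH t q : ratr q <= t -> G q <= H t.
  move=> qt; apply: lb_le_inf => // _ [p /= tp <-]; apply: ndG.
  exact: le_trans (ltW tp).
have ltH t e : 0 < e -> exists2 q, t < ratr q & G q < H t + e.
  move=> e0; have [|_ [q tq <-] Gq] := @inf_adherent _ (S t) e e0.
    by split.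
  by exists q.
have ndH : {homo H : s t / s <= t}.
  move=> s t st; apply: lb_le_inf => // _ [p /= tp <-]; apply: HG.
  exact: le_lt_trans tp.
exists phi, H; split=> //.
- move=> t; apply/cvgrPdist_lt => e e0.
  have [q tq Gq] := ltH t e e0.
  near=> x; rewrite distrC ger0_norm ?subr_ge0 ?ndH//.
  rewrite ltrBlDl; apply: le_lt_trans Gq; apply: HG.
  by near: x; exact: nbhs_right_lt.
- split=> [t Ft s st|t].
    have /rat_in_itvoo[q /itvP qt] := st.
    apply/eqP; rewrite eq_le; apply/andP; split; last first.
      by apply: lb_le_inf => // _ [p _ <-].
    suff <- : G q = 0 by apply: HG; rewrite qt.
    apply: (cvg_unique _ (FG q)) => //.
    have -> : (fun n => F (phi n) (ratr q)) = cst 0.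
      by apply/funext => n; apply: Ft; rewrite qt.
    exact: cvg_cst.
  by apply: lb_le_inf => // _ [p _ <-].
- move=> t ctH; apply/cvgrPdist_lt => e e0.
  have [q tq Gq] := ltH t e e0.
  have : \forall s \near t, `|H t - H s| < e.
    by move/cvgrPdist_lt : ctH; apply.
  move=> /nbhs_ballP[d /= d0 dH].
  (* Continuity of H from the left enters here: such a p satisfies G p >= H(t - d / 2) > H t - e. *)
  have /rat_in_itvoo[p /itvP pt] : t - d / 2 < t by rewrite ltrBlDr ltrDl divr_gt0.
  have Gp : H t - e < G p.
    have td : ball t d (t - d / 2).
      rewrite /ball/= opprB addrC subrK gtr0_norm ?divr_gt0//; lra.
    have td' : t - d / 2 <= t by lra.
    have := dH _ td; rewrite ger0_norm ?subr_ge0 ?ndH// => Ht.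
    have : H (t - d / 2) <= G p by apply: HG; rewrite pt.
    lra.
  have h1 : \forall n \near \oo, F (phi n) (ratr q) < H t + e.
    by apply: cvgr_lt Gq; exact: FG.
  have h2 : \forall n \near \oo, H t - e < F (phi n) (ratr p).
    by apply: cvgr_gt Gp; exact: FG.
  apply: filterS2 h1 h2 => n h1 h2; rewrite ltr_norml.
  have h3 : F (phi n) t <= F (phi n) (ratr q) by apply/ndF/ltW.
  have h4 : F (phi n) (ratr p) <= F (phi n) t by apply/ndF; rewrite pt.
  by apply/andP; split; lra.
Unshelve. all: by end_near. Qed.

End helly_selection.

(** * Bernstein's theorem *)

Section exponential_integrals.
Context {R : realType}.
Implicit Types x t : R.
Local Notation leb := (@lebesgue_measure R).

Lemma is_derive_expRN x t :
  is_derive t 1 (fun s => expR (- (x * s))) (- x * expR (- (x * t))).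
Proof.
have D : is_derive t 1 (fun s => - (x * s)) (- x).
  by apply: is_derive_eq; rewrite /GRing.scale /= mulr1.
have := @is_derive1_comp _ expR (fun s => - (x * s)) t _ _ (is_derive_expR _) D.
by move/is_derive_eq; apply; rewrite mulrC.
Qed.

Lemma continuous_expRN x : continuous (fun s : R => expR (- (x * s))).
Proof.
move=> t; apply: differentiable_continuous; apply/derivable1_diffP.
by have [] := is_derive_expRN x t.
Qed.

Lemma measurable_expRN x (D : set (measurableTypeR R)) :
  measurable_fun D (fun s : R => expR (- (x * s))).
Proof.
apply: measurable_funTS; apply: continuous_measurable_fun.
exact: continuous_expRN.
Qed.

(** Presents e^(-x t) as a tail integral, the form in which Tonelli's theorem passes from the
    transform of a measure to that of its distribution function. *)
Lemma integral_expR_tail x t : 0 < x ->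
  (\int[leb]_(s in `[t, +oo[) (x * expR (- (x * s)))%:E =
   (expR (- (x * t)))%:E)%E.
Proof.
move=> x0.
have D (s : R) : is_derive s 1 (fun s => - expR (- (x * s))) (x * expR (- (x * s))).
  have := is_deriveN (is_derive_expRN x s).
  by move/is_derive_eq; apply; rewrite mulNr opprK.
rewrite (@ge0_continuous_FTC2y _ _ (fun s => - expR (- (x * s))) _ 0).
- by rewrite sub0e EFinN oppeK.
- by move=> s _; rewrite mulr_ge0 ?expR_ge0// ltW.
- apply: continuous_subspaceT => s; apply: cvgM; first exact: cvg_cst.
  exact: continuous_expRN.
- rewrite -oppr0; apply: cvgN.
  apply: (@cvg_comp _ _ _ (fun s => x * s) (fun z => expR (- z)) _ (pinfty_nbhs R)); last exact: cvgr_expR.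
  exact: gt0_cvgMry.
- by move=> s _; have [] := D s.
- apply: cvgN; apply/cvg_at_right_filter; exact: continuous_expRN.
- by move=> s _; rewrite derive1E; have [] := D s.
Qed.

Lemma integrable_expRN x : 0 < x ->
  leb.-integrable `[0, +oo[ (fun s => (expR (- (x * s)))%:E).
Proof.
move=> x0.
have -> : (fun s => (expR (- (x * s)))%:E) =
    (fun s => (x^-1)%:E * (x * expR (- (x * s)))%:E)%E.
  by apply/funext => s; rewrite -EFinM mulKf// gt_eqF.
apply: integrableZl => //; apply/integrableP; split.
  apply/measurable_EFinP/measurable_funM; [exact: measurable_cst|exact: measurable_expRN].
under eq_integral do rewrite gee0_abs ?lee_fin ?mulr_ge0 ?expR_ge0 ?(ltW x0)//.
by rewrite integral_expR_tail// ltry.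
Qed.

End exponential_integrals.

(** * Tonelli's theorem for tail integrals *)

Section layer_cake.
Context {R : realType}.
Variable m : {sigma_finite_measure set (measurableTypeR R) -> \bar R}.
Local Notation leb := (@lebesgue_measure R).

(** Tonelli on the region 0 <= u <= s. It serves as integration by parts twice: with w(s) = x e^(-x
    s) for Laplace transforms, and with w the indicator of s <= t for integrals of a distribution
    function. *)
Lemma layer_cake (w : R -> R) :
  (forall s, 0 <= w s) -> measurable_fun setT w ->
  (\int[m]_(u in `[0%R, +oo[) \int[leb]_(s in `[u, +oo[) (w s)%:E =
   \int[leb]_(s in `[0%R, +oo[) ((w s)%:E * m `[0%R, s]%classic))%E.
Proof.
move=> w0 mw.
pose E := [set z : measurableTypeR R * measurableTypeR R | 0 <= z.1 /\ z.1 <= z.2].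
have mE : measurable E.
  have m1 : measurable_fun setT (fun z : measurableTypeR R * measurableTypeR R =>
      ((0 : R) <= z.1) && (z.1 <= z.2)).
    by apply: measurable_and; apply: measurable_fun_ler.
  have := m1 measurableT [set true] (I : measurable [set true]).
  rewrite setTI; congr measurable; apply/seteqP; split => z /=.
    by move=> /andP[].
  by move=> [-> ->].
pose f z := ((w z.2)%:E * (\1_E z)%:E)%E.
have mf : measurable_fun setT f.
  apply: emeasurable_funM; apply/measurable_EFinP.
    exact: measurableT_comp mw measurable_snd.
  exact: measurable_indic.
have f0 z : (0 <= f z)%E by rewrite mule_ge0 ?lee_fin.
have EE u s : (u, s) \in E = (0 <= u) && (u <= s).
  by apply/idP/andP; rewrite inE.
have := fubini_tonelli (m1 := m) (m2 := leb) f mf f0.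
have -> : (\int[m]_x fubini_F leb f x =
  \int[m]_(u in `[0%R, +oo[) \int[leb]_(s in `[u, +oo[) (w s)%:E)%E.
  rewrite [RHS]integral_mkcond; apply: eq_integral => u _.
  rewrite patchE mem_setE in_itv/= andbT /fubini_F /f; case: ifPn => u0.
    rewrite [RHS]integral_mkcond; apply: eq_integral => s _.
    rewrite patchE mem_setE in_itv/= andbT indicE EE u0/=.
    by case: ifPn; rewrite ?mule1 ?mule0.
  by apply: integral0_eq => s _; rewrite indicE EE (negbTE u0) mule0.
move=> ->.
rewrite [RHS]integral_mkcond; apply: eq_integral => s _.
rewrite patchE mem_setE in_itv/= andbT /fubini_G /f.
case: ifPn => s0; last first.
  apply: integral0_eq => u _; rewrite indicE EE.
  case: (lerP 0 u) => u0; last by rewrite mule0.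
  by rewrite leNgt (lt_le_trans _ u0) ?mule0// ltNge.
rewrite (eq_integral (fun u : measurableTypeR R =>
    (w s)%:E * (\1_(`[0, s]%classic : set (measurableTypeR R)) u)%:E)%E).
  rewrite ge0_integralZl//; last 2 first.
  - exact/measurable_EFinP/measurable_indic.
  - by rewrite lee_fin.
  by rewrite integral_indic// setIT.
by move=> u _; rewrite !indicE EE mem_setE in_itv.
Qed.
End layer_cake.

(** * Feller's discrete approximations *)

Section feller_approximation.
Context {R : realType}.
Variable g : R -> R.
Hypothesis cmg : completely_monotonic g.
Variable l : R.
Hypothesis l0 : 0 < l.
Local Notation leb := (@lebesgue_measure R).

Definition feller_mass (n : nat) : R := l ^+ n * ((-1) ^+ n * g^`(n) l) / n`!%:R.

Definition feller_node (x : R) : R := l * (1 - expR (- (x / l))).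

(** The mass of the nodes n / l up to t. The series is finite by [feller_cdfE], so [fine] loses
    nothing. *)
Definition feller_cdf (t : R) : R :=
  fine (\sum_(n <oo) (feller_mass n * (n%:R / l <= t)%R%:R)%:E)%E.

Lemma feller_mass_ge0 n : 0 <= feller_mass n.
Proof.
by rewrite divr_ge0// mulr_ge0 ?exprn_ge0 ?(ltW l0)//; exact: cmg.2.
Qed.

(** The node is chosen so that l - [feller_node x] = l e^(-x / l); the n-th power of this is l^n
    e^(-x n / l), and the Taylor series of g at l becomes a Laplace transform. *)
Lemma feller_series x : 0 < x ->
  (\sum_(n <oo) (feller_mass n * expR (- (x * (n%:R / l))))%:E =
   (g (feller_node x))%:E)%E.
Proof.
move=> x0.
have node : 0 < feller_node x <= l.
  apply/andP; split.
    by rewrite mulr_gt0// subr_gt0 expR_lt1 oppr_lt0 divr_gt0.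
  by rewrite ger_pMr// gerBl expR_ge0.
apply/cvg_lim => //.
have := cm_taylor cmg node.
rewrite (_ : l - feller_node x = l * expR (- (x / l))); last first.
  by rewrite /feller_node; ring.
move=> T; apply: cvg_EFin.
  by apply: nearW => n; rewrite sumEFin.
apply: cvg_trans T; apply: near_eq_cvg; apply: nearW => n.
rewrite /= sumEFin /= big_mkord; apply: eq_bigr => i _.
rewrite /feller_mass exprMn -expRM_natl.
have -> : i%:R * (- (x / l)) = - (x * (i%:R / l)) by ring.
by ring.
Qed.

(** An exponential Markov bound: the indicator of n / l <= t is at most e^(x t) e^(-x n / l), and
    the series of the latter is known. Applied with any one x, it also shows finiteness. *)
Lemma feller_cdfE x t : 0 < x ->
  ((feller_cdf t)%:E = \sum_(n <oo) (feller_mass n * (n%:R / l <= t)%R%:R)%:E)%E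
  /\ feller_cdf t <= expR (x * t) * g (feller_node x).
Proof.
move=> x0.
have le : (\sum_(n <oo) (feller_mass n * (n%:R / l <= t)%R%:R)%:E <=
    (expR (x * t) * g (feller_node x))%:E)%E.
  rewrite EFinM -feller_series// -nneseriesZl; last first.
    by move=> n _; rewrite lee_fin mulr_ge0 ?feller_mass_ge0 ?expR_ge0.
  apply: lee_nneseries => [n _ _|n _].
    by rewrite lee_fin mulr_ge0 ?feller_mass_ge0.
  rewrite -EFinM lee_fin mulrCA ler_wpM2l ?feller_mass_ge0//.
  rewrite -expRD; case: (boolP (n%:R / l <= t)) => h; last exact: expR_ge0.
  have : expR 0 <= expR (x * t - x * (n%:R / l)) by rewrite ler_expR subr_ge0 ler_pM2l.
  by rewrite expR0.
have fin : (\sum_(n <oo) (feller_mass n * (n%:R / l <= t)%R%:R)%:E)%E \is a fin_num.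
  rewrite ge0_fin_numE; first exact: le_lt_trans le (ltry _).
  by apply: nneseries_ge0 => n _ _; rewrite lee_fin mulr_ge0 ?feller_mass_ge0.
by rewrite /feller_cdf fineK//; split=> //; rewrite -lee_fin fineK.
Qed.

Lemma feller_cdf_ge0 t : 0 <= feller_cdf t.
Proof.
rewrite -lee_fin (feller_cdfE t ltr01).1.
by apply: nneseries_ge0 => n _ _; rewrite lee_fin mulr_ge0 ?feller_mass_ge0.
Qed.

Lemma feller_cdf_nd : {homo feller_cdf : s t / s <= t}.
Proof.
move=> s t st; rewrite -lee_fin (feller_cdfE s ltr01).1 (feller_cdfE t ltr01).1.
apply: lee_nneseries => [n _ _|n _].
  by rewrite lee_fin mulr_ge0 ?feller_mass_ge0.
rewrite lee_fin ler_wpM2l ?feller_mass_ge0//.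
by case: (boolP (_ <= s)) => // h; rewrite (le_trans h st).
Qed.

Lemma feller_cdf_lt0 t : t < 0 -> feller_cdf t = 0.
Proof.
move=> t0; rewrite /feller_cdf eseries0// => n _ _.
by rewrite leNgt (lt_le_trans t0) ?divr_ge0 ?(ltW l0)// mulr0.
Qed.

(** Term by term, e^(-x n / l) is the tail integral from n / l. Stating the transform through the
    distribution function leaves only a pointwise limit of functions to be taken under a Lebesgue
    integral. *)
Lemma feller_laplace x : 0 < x ->
  (\int[leb]_(t in `[0%R, +oo[) (x * expR (- (x * t)) * feller_cdf t)%:E =
   (g (feller_node x))%:E)%E.
Proof.
move=> x0; rewrite -feller_series//.
pose h n (t : measurableTypeR R) :=
  (x * expR (- (x * t)) * (feller_mass n * (n%:R / l <= t)%R%:R))%:E.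
rewrite (eq_integral (fun t => \sum_(n <oo) h n t)%E); last first.
  move=> t _; rewrite EFinM (feller_cdfE t x0).1 -nneseriesZl//.
  by move=> n _; rewrite lee_fin mulr_ge0 ?feller_mass_ge0.
have mx (D : set (measurableTypeR R)) :
    measurable_fun D (fun t => (x * expR (- (x * t)))%:E).
  apply/measurable_EFinP/measurable_funM; first exact: measurable_cst.
  exact: measurable_expRN.
have x_ge0 t : (0 <= (x * expR (- (x * t)))%:E)%E.
  by rewrite lee_fin mulr_ge0 ?expR_ge0// ltW.
rewrite integral_nneseries//; last 2 first.
- move=> n; rewrite [X in measurable_fun _ X](_ : _ = (fun t =>
    (x * expR (- (x * t)))%:E * (feller_mass n)%:E *
    (\1_(`[n%:R / l, +oo[%classic : set (measurableTypeR R)) t)%:E)%E).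
    apply: emeasurable_funM; first exact: emeasurable_funM.
    exact/measurable_EFinP/measurable_indic.
  apply/funext => t; rewrite -!EFinM indicE mem_setE in_itv/= andbT.
  by rewrite /h mulrA.
- move=> n t _; have := x_ge0 t; rewrite !lee_fin => xt0.
  by rewrite mulr_ge0// mulr_ge0//; exact: feller_mass_ge0.
apply: eq_eseriesr => n _.
rewrite EFinM -(integral_expR_tail _ x0) -ge0_integralZl_EFin//; last first.
  exact: feller_mass_ge0.
rewrite integral_mkcond [RHS]integral_mkcond; apply: eq_integral => t _.
rewrite !patchE !mem_setE !in_itv/= !andbT /h.
case: (lerP (n%:R / l) t) => nt; last by rewrite !mulr0 if_same.
rewrite (le_trans _ nt) ?divr_ge0 ?(ltW l0)//.
by rewrite mulr1 mulrC EFinM.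
Qed.

End feller_approximation.

(** * Passage to the limit in Bernstein's theorem *)

Section bernstein.
Context {R : realType}.
Local Notation leb := (@lebesgue_measure R).

Lemma cm_nonincreasing (g : R -> R) (x y : R) : completely_monotonic g ->
  0 < x -> x <= y -> g y <= g x.
Proof.
move=> [sg pg] x0 xy; rewrite -lerN2.
apply: (is_derive_ge0_le (f := fun z => - g z) (df := fun z => - g^`() z)) => //.
  move=> z /andP[xz _]; apply: is_deriveN.
  by apply: derivable_is_derive1; apply: (sg 0%N); exact: lt_le_trans xz.
move=> z /andP[xz _]; have := pg 1%N z (lt_trans x0 xz).
by rewrite expr1 mulN1r derive1n1.
Qed.

Lemma cm_continuous (g : R -> R) (x : R) : completely_monotonic g -> 0 < x ->
  {for x, continuous g}.
Proof.
move=> [sg _] x0; apply: differentiable_continuous; apply/derivable1_diffP.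
exact: sg 0%N x x0.
Qed.

(** Both bounds are 1 + y <= e^y, at y = x / l and at y = - x / l. *)
Lemma feller_node_bounds (l x : R) : 0 < l -> 0 < x ->
  x / (1 + x / l) <= feller_node l x <= x.
Proof.
move=> l0 x0; have s0 : 0 < x / l by rewrite divr_gt0.
have e1 := expR_ge1Dx (x / l).
have e2 := expR_ge1Dx (- (x / l)).
have -> : x / (1 + x / l) = l * (1 - (1 + x / l)^-1).
  by field; rewrite !gt_eqF// ?addr_gt0//.
have xE : l * (x / l) = x by field; rewrite gt_eqF.
rewrite /feller_node; apply/andP; split.
  by rewrite ler_pM2l// lerD2l lerN2 expRN lef_pV2 ?posrE ?expR_gt0// addr_gt0.
by rewrite -[leRHS]xE ler_pM2l//; lra.
Qed.

Lemma feller_node_cvg (x : R) : 0 < x ->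
  feller_node n.+1%:R x @[n --> \oo] --> x.
Proof.
move=> x0.
apply: (@squeeze_cvgr _ _ _ _ (fun n => x / (1 + x * n.+1%:R^-1)) (cst x)).
- by apply: nearW => n; apply: feller_node_bounds.
- have C : x / (1 + x * n.+1%:R^-1) @[n --> \oo] --> x / (1 + x * 0).
    apply: cvgM; first exact: cvg_cst.
    apply: cvgV; first by rewrite mulr0 addr0 oner_neq0.
    apply: cvgD; first exact: cvg_cst.
    apply: cvgM; first exact: cvg_cst.
    exact: cvg_harmonic.
  by move: C; rewrite mulr0 addr0 divr1.
- exact: cvg_cst.
Qed.

Lemma nondecreasing_ae_continuous (H : R -> R) : {homo H : s t / s <= t} ->
  (forall t, H x @[x --> t^'+] --> H t) -> {ae leb, forall t, {for t, continuous H}}.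
Proof.
move=> ndH rcH.
exists (\bigcup_n [set x | x \in `](- n%:R : R), n%:R[%R /\ discontinuity H x]).
have cD : countable (\bigcup_n [set x | x \in `](- n%:R : R), n%:R[%R /\ discontinuity H x]).
  apply: bigcup_countable => // n _; apply: discontinuity_countable.
  by move=> s t _ _; exact: ndH.
split.
  apply: countable_measurable cD => t; exact: measurable_set1.
  exact: countable_lebesgue_measure0.
move=> t /= nct.
  have cl : cvg (H x @[x --> t^'-]).
    apply: nondecreasing_at_left_is_cvgr.
      by apply: nearW => x s u _ _; exact: ndH.
    apply: nearW => x; exists (H t) => _ /= [s + <-].
    by rewrite in_itv/= => /andP[_ /ltW]; exact: ndH.
  exists (Num.truncn `|t|).+1 => //=; split.
    by rewrite in_itv/= -ltr_norml truncnS_gt.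
  split=> //; first by apply/cvg_ex; exists (H t).
  apply: contra_notN nct => /eqP E.
  apply/left_right_continuousP; split=> //.
  by rewrite -(cvg_lim _ (rcH t))// -E.
Qed.

(** As l = n + 1 >= 1, the node stays above x / (1 + x), and g is nonincreasing. The resulting bound
    is uniform in n, as Helly's theorem and dominated convergence require. *)
Lemma feller_cdf_bound (g : R -> R) (x t : R) n : completely_monotonic g ->
  0 < x -> feller_cdf g n.+1%:R t <= expR (x * t) * g (x / (1 + x)).
Proof.
move=> cmg x0; have n0 : 0 < n.+1%:R :> R by [].
apply: le_trans (feller_cdfE cmg n0 t x0).2 _.
rewrite ler_wpM2l ?expR_ge0//; apply: cm_nonincreasing => //.
  by rewrite divr_gt0// addr_gt0.
apply: le_trans (andP (feller_node_bounds n0 x0)).1.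
rewrite ler_pM2l// lef_pV2 ?posrE ?addr_gt0 ?divr_gt0//.
rewrite lerD2l ler_pdivrMr// ler_peMr ?(ltW x0)//.
by rewrite ler1n.
Qed.

Lemma bernstein_cdf (g : R -> R) : completely_monotonic g ->
  exists H : R -> R, [/\ {homo H : s t / s <= t},
    (forall t, H x @[x --> t^'+] --> H t), (forall t, t < 0 -> H t = 0) &
    forall x, 0 < x -> (\int[leb]_(t in `[0%R, +oo[)
       (x * expR (- (x * t)) * H t)%:E = (g x)%:E)%E].
Proof.
move=> cmg; have n0 n : 0 < n.+1%:R :> R by [].
pose F n := feller_cdf g n.+1%:R.
have [|n t|phi [H [phin ndH rcH [H0 Hge0] FH]]] :=
    @helly R F (fun t => expR (1 * t) * g (1 / (1 + 1))).
- by move=> n; exact: feller_cdf_nd.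
- by rewrite feller_cdf_ge0//= feller_cdf_bound.
exists H; split=> // [t t0|x]; last move=> x0.
  by apply: (H0 0) => // s s0 n; exact: feller_cdf_lt0.
pose f n (t : R) := (x * expR (- (x * t)) * F (phi n) t)%:E.
pose h (t : R) := (x * expR (- (x * t)) * H t)%:E.
have mf (G : R -> R) : {homo G : s t / s <= t} ->
    measurable_fun (`[0%R, +oo[%classic : set (measurableTypeR R))
      (fun t => (x * expR (- (x * t)) * G t)%:E).
  move=> ndG; apply/measurable_EFinP/measurable_funM.
    apply/measurable_funM; first exact: measurable_cst.
    exact: measurable_expRN.
  exact: nondecreasing_measurable.
(* The uniform bound is used at x / 2: its growth e^(x t / 2) leaves the integrable majorant x g(c)
   e^(-x t / 2). *)
have x20 : 0 < x / 2 by rewrite divr_gt0.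
pose c := x / 2 / (1 + x / 2).
have c0 : 0 < c by rewrite divr_gt0// addr_gt0.
have [] := @dominated_convergence _ _ _ leb `[0%R, +oo[%classic
    (measurable_itv _) f h (fun t => (x * g c)%:E * (expR (- (x / 2 * t)))%:E)%E.
- by move=> n; apply: mf; exact: feller_cdf_nd.
- exact: mf.
(* Helly's theorem gives convergence only where H is continuous, hence almost everywhere. *)
- have [N [mN N0 sN]] := nondecreasing_ae_continuous ndH rcH.
  exists N; split=> // t /= nt; apply: sN => /= /FH Ft; apply: nt => _.
  apply: cvg_EFin; first exact: nearW.
  by apply: cvgM => //; exact: cvg_cst.
- exact/integrableZl/integrable_expRN.
- apply: aeW => t n _; rewrite /f -EFinM lee_fin ger0_norm; last first.
    by rewrite !mulr_ge0 ?expR_ge0 ?(ltW x0)// feller_cdf_ge0.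
  apply: le_trans (_ : x * expR (- (x * t)) * (expR (x / 2 * t) * g c) <= _).
    rewrite ler_wpM2l ?mulr_ge0 ?expR_ge0 ?(ltW x0)//.
    exact: feller_cdf_bound.
  have -> : expR (- (x / 2 * t)) = expR (- (x * t)) * expR (x / 2 * t).
    by rewrite -expRD; congr expR; field.
  by rewrite le_eqVlt; apply/orP; left; apply/eqP; ring.
move=> _ _ fh; apply: (cvg_unique _ fh) => //.
rewrite [X in X @ _](_ : _ = (fun n => (g (feller_node (phi n).+1%:R x))%:E)).
  apply: cvg_EFin; first exact: nearW.
  apply: (@cvg_comp _ _ _ (fun n => feller_node (phi n).+1%:R x) g _ (nbhs x)).
    have phioo : phi n @[n --> \oo] --> \oo.
      move=> A [N _ NA]; exists N => // n Nn; apply: NA.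
      exact: leq_trans Nn (phin n).
    exact: cvg_comp phioo (feller_node_cvg x0).
  exact: cm_continuous.
by apply/funext => n; rewrite -feller_laplace.
Qed.

Lemma lebesgue_stieltjes_itv_oc (H : cumulative R R) (a b : R) : a <= b ->
  (lebesgue_stieltjes_measure H `]a, b]%classic = (H b - H a)%:E)%E.
Proof.
move=> ab; rewrite /lebesgue_stieltjes_measure/= /measure_extension/=.
by rewrite measurable_mu_extE/= ?wlength_itv_bnd//; exact: is_ocitv.
Qed.

Theorem bernstein (g : R -> R) : completely_monotonic g ->
  exists m : {sigma_finite_measure set (measurableTypeR R) -> \bar R},
    m `]-oo, 0[%classic = 0%E /\
    forall x, 0 < x ->
      (\int[m]_(s in `[0%R, +oo[) (expR (- (x * s)))%:E = (g x)%:E)%E.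
Proof.
move=> /bernstein_cdf[H [ndH rcH H0 HL]].
pose Hc : cumulative R R := HB.pack H (isCumulative.Build R _ R H ndH rcH).
pose m : {sigma_finite_measure set (measurableTypeR R) -> \bar R} :=
  lebesgue_stieltjes_measure Hc.
have m_oc a b : a <= b -> m `]a, b]%classic = (H b - H a)%:E.
  by move=> ab; exact: lebesgue_stieltjes_itv_oc.
have mneg : m `]-oo, 0[%classic = 0%E.
  (* These intervals exhaust (-oo, 0) and have both endpoints where H vanishes. *)
  pose A n : set (measurableTypeR R) :=
    `](- n.+1%:R : R), (- n.+1%:R^-1)]%classic.
  have mA n : m (A n) = 0%E.
    have n1 : (n.+1%:R : R)^-1 <= n.+1%:R.
      by rewrite (@le_trans _ _ 1)// ?ler1n// invf_le1// ler1n.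
    have n0 : 0 < (n.+1%:R : R)^-1 by rewrite invr_gt0.
    by rewrite m_oc ?H0 ?subr0// ?oppr_lt0 ?lerN2.
  apply/eqP; rewrite eq_le measure_ge0 andbT.
  rewrite (_ : 0%E = \sum_(n <oo) m (A n))%E; last first.
    by rewrite eseries0// => n _ _; exact: mA.
  apply: measure_sigma_subadditive => [n||x /=].
  - exact: measurable_itv.
  - exact: measurable_itv.
  rewrite in_itv/= => x0.
  have y0 : 0 < (- x)^-1 by rewrite invr_gt0 oppr_gt0.
  have := truncnS_gt (- x + (- x)^-1).
  set n := Num.truncn _ => nx; exists n => //=.
  rewrite /A/= in_itv/=; apply/andP; split; first by lra.
  rewrite lerNr -[leRHS]invrK lef_pV2 ?posrE//.
  by rewrite ltW// (lt_trans _ nx)// ltrDr oppr_gt0.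
have m_cc t : 0 <= t -> m `[0, t]%classic = (H t)%:E.
  (* Starting at -1, where H is 0, records the full value H t, including an atom of mass H 0 at the
     origin. *)
  move=> t0; have <- : m `](-1), t]%classic = (H t)%:E.
    have h1 : -1 <= t by rewrite (le_trans _ t0)// lerN10.
    by rewrite m_oc// (H0 (-1)) ?subr0// ltrN10.
  have -> : `](-1 : R), t]%classic = `]-1, 0[%classic `|` `[0, t]%classic.
    apply/seteqP; split=> x /=; rewrite !in_itv/=.
      by case: (ltP x 0) => x0 /andP[-> xt]; [left|right; rewrite xt].
    by move=> [/andP[-> x0]|/andP[x0 ->]]; rewrite ?andbT/=; lra.
  have -> : m (`](-1 : R), 0[%classic `|` `[0, t]%classic) =
      (m `](-1)%R, 0%R[%classic + m `[0%R, t]%classic)%E.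
    apply: measureU; [exact: measurable_itv|exact: measurable_itv|].
    rewrite -subset0 => x [/=]; rewrite !in_itv/= => /andP[_ x0] /andP[].
    by rewrite leNgt x0.
  have -> : m `](-1 : R), 0[%classic = 0%E.
    apply/eqP; rewrite -measure_le0 -mneg; apply: le_measure.
    - by rewrite inE; exact: measurable_itv.
    - by rewrite inE; exact: measurable_itv.
    - by move=> x /=; rewrite !in_itv/= => /andP[].
  by rewrite add0e.
exists m; split; first exact: mneg.
move=> x x0; rewrite -(HL x x0).
transitivity (\int[m]_(u in `[0%R, +oo[)
    \int[leb]_(s in `[u, +oo[) (x * expR (- (x * s)))%:E)%E.
  by apply: eq_integral => u _; rewrite integral_expR_tail.
rewrite layer_cake; last 2 first.
- by move=> s; rewrite mulr_ge0 ?expR_ge0// ltW.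
- by apply/measurable_funM; [exact: measurable_cst|exact: measurable_expRN].
apply: eq_integral => s; rewrite inE/= in_itv/= andbT => s0.
by rewrite m_cc// EFinM.
Qed.

End bernstein.

(** * Uniqueness of Laplace transforms *)

Section threshold_functions.
Context {R : realType}.

Lemma bernoulli_le (v : R) n : 0 <= v <= 1 -> 1 - n%:R * v <= (1 - v) ^+ n.
Proof.
move=> /andP[v0 v1]; elim: n => [|n IH]; first by rewrite mul0r subr0 expr0.
rewrite exprS; apply: (@le_trans _ _ ((1 - v) * (1 - n%:R * v))).
  rewrite -natr1 -subr_ge0.
  have -> : (1 - v) * (1 - n%:R * v) - (1 - (n%:R + 1) * v) = n%:R * (v * v).
    by ring.
  by rewrite !mulr_ge0.
by rewrite ler_wpM2l// subr_ge0.
Qed.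

Lemma bernoulli_inv_le (v : R) n : 0 <= v <= 1 ->
  (1 - v) ^+ n * (1 + n%:R * v) <= 1.
Proof.
move=> /andP[v0 v1]; elim: n => [|n IH]; first by rewrite mul0r addr0 expr0 mul1r.
apply: le_trans IH; rewrite exprSr -mulrA ler_wpM2l//.
  by rewrite exprn_ge0// subr_ge0.
rewrite -natr1 -subr_ge0.
have -> : 1 + n%:R * v - (1 - v) * (1 + (n%:R + 1) * v) = (n%:R + 1) * (v * v).
  by ring.
by rewrite !mulr_ge0// addr_ge0.
Qed.

(* [1 - e^(-x t)] with [e^(x T) = 2 ^ n], raised to a power that exceeds [2 ^ n] by
   a factor tending to infinity, so that the limit at [t = T] is 0. *)
Definition threshold (T : R) (n : nat) (t : R) : R :=
  (1 - expR (- (n%:R * (ln 2 / T) * t))) ^+ (n * 2 ^ n).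

(** With v the exponential and N the exponent, N v = n e^(-n b) for b = ln 2 (t / T - 1). If t <= T
    then N v >= n and (1 - v)^N <= 1 / (1 + N v) tends to 0; if t > T then N v tends to 0 and (1 -
    v)^N >= 1 - N v tends to 1. *)
Lemma threshold_cvg (T t : R) : 0 < T -> 0 <= t ->
  threshold T n t @[n --> \oo] --> ((T < t)%R%:R : R).
Proof.
move=> T0 t0; have l0 : 0 < ln 2 :> R by rewrite ln_gt0// ltr1n.
pose b := ln 2 * (t / T - 1).
pose v n := expR (- (n%:R * (ln 2 / T) * t)).
have v01 n : 0 <= v n <= 1.
  rewrite expR_ge0/= expR_le1 oppr_le0 !mulr_ge0// ?invr_ge0; exact: ltW.
have Nv n : (n * 2 ^ n)%:R * v n = n%:R * expR (- (n%:R * b)).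
  have two : 2 = expR (ln 2) :> R by rewrite lnK// posrE.
  rewrite natrM natrX {1}two -expRM_natl /v -mulrA -expRD.
  by congr (_ * expR _); rewrite /b; field; rewrite gt_eqF.
have [tT|Tt] := lerP t T.
  have b0 : b <= 0 by rewrite pmulr_rle0// subr_le0 ler_pdivrMr// mul1r.
  apply: (@squeeze_cvgr _ _ _ _ (cst 0) harmonic).
  - apply: nearW => n /=; apply/andP; split.
      by rewrite exprn_ge0// subr_ge0; case/andP: (v01 n).
    have := bernoulli_inv_le (n * 2 ^ n) (v01 n); rewrite Nv => h.
    have e1 : 1 <= expR (- (n%:R * b)).
      by rewrite -expR0 ler_expR oppr_ge0 mulr_ge0_le0.
    have n1 : (n.+1%:R : R) <= 1 + n%:R * expR (- (n%:R * b)).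
      by rewrite -natr1 addrC lerD2l ler_peMr.
    rewrite -[leRHS]mul1r ler_pdivlMr//; apply: le_trans h.
    rewrite ler_wpM2l// exprn_ge0// subr_ge0; by case/andP: (v01 n).
  - exact: cvg_cst.
  - exact: cvg_harmonic.
have b0 : 0 < b by rewrite mulr_gt0// subr_gt0 ltr_pdivlMr// mul1r.
(* From e^y >= y^2 / 2 at y = n b one gets n e^(-n b) <= 2 / (b^2 n). *)
apply: (@squeeze_cvgr _ _ _ _ (fun n => 1 - 2 / b ^+ 2 * n%:R^-1) (cst 1)).
- near=> n; apply/andP; split; last first.
    rewrite exprn_ile1// ?subr_ge0 ?gerBl; by case/andP: (v01 n).
  have n0 : 0 < n%:R :> R by rewrite ltr0n; near: n; exact: nbhs_infty_gt.
  apply: le_trans (bernoulli_le (n * 2 ^ n) (v01 n)).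
  rewrite Nv lerD2l lerN2.
  have nb0 : 0 <= n%:R * b by rewrite mulr_ge0// ltW.
  have := expR_ge1Dxn 1 nb0; rewrite (_ : 2`! = 2)%N// => h.
  rewrite expRN ler_pdivrMr ?expR_gt0//.
  apply: (@le_trans _ _ (2 / b ^+ 2 * n%:R^-1 * ((n%:R * b) ^+ 2 / 2))).
    by rewrite le_eqVlt; apply/orP; left; apply/eqP; field; rewrite !gt_eqF.
  rewrite ler_wpM2l//; last by apply: le_trans h; rewrite lerDr.
  by rewrite mulr_ge0// ?invr_ge0 ?divr_ge0// ?sqr_ge0// ltW.
- have C : (1 - 2 / b ^+ 2 * n%:R^-1) @[n --> \oo] --> 1 - 2 / b ^+ 2 * 0.
    apply: cvgB; first exact: cvg_cst.
    apply: cvgM; first exact: cvg_cst.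
    apply/gtr0_cvgV0; last exact: cvgr_idn.
    by apply: filterS (nbhs_infty_gt 0) => n; rewrite ltr0n.
  by move: C; rewrite mulr0 subr0.
- exact: cvg_cst.
Unshelve. all: by end_near. Qed.

End threshold_functions.

(** * Integrals of exponentials against a weighted measure *)

Section weighted_laplace.
Context {R : realType}.
Variables (s : {measure set (measurableTypeR R) -> \bar R}) (w : R -> R).
Local Notation D := (`[0%R, +oo[%classic : set (measurableTypeR R)).

Implicit Types (phi psi : R -> R) (x y t T : R) (N : nat).

(** Keeping measure and weight apart covers t dsigma_j, q_j dt and sigma_k alike, with weights t,
    q_j (up to a constant) and 1. *)
Definition wint (phi : R -> R) : \bar R := (\int[s]_(t in D) (phi t * w t)%:E)%E.

Definition weight_ok :=
  [/\ forall t, 0 <= t -> 0 <= w t, measurable_fun D w &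
      forall x, 0 < x -> (wint (fun t => expR (- (x * t)))%R < +oo)%E].

Hypothesis wok : weight_ok.

Let mD : measurable D. Proof. exact: measurable_itv. Qed.

Let D0 t : D t -> 0 <= t. Proof. by rewrite /= in_itv/= andbT. Qed.

Let mphi phi : measurable_fun D phi ->
  measurable_fun D (fun t => (phi t * w t)%:E).
Proof.
by move=> mp; apply/measurable_EFinP/measurable_funM => //; case: wok.
Qed.

Lemma wint_ge0 phi : (forall t, 0 <= t -> 0 <= phi t) -> (0 <= wint phi)%E.
Proof.
move=> p0; apply: integral_ge0 => t /D0 t0; rewrite lee_fin mulr_ge0 ?p0//.
by have [w0 _ _] := wok; exact: w0.
Qed.

Lemma wintD phi psi : (forall t, 0 <= t -> 0 <= phi t) ->
  (forall t, 0 <= t -> 0 <= psi t) -> measurable_fun D phi -> measurable_fun D psi ->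
  (wint (fun t => phi t + psi t)%R = wint phi + wint psi)%E.
Proof.
move=> p0 q0 mp mq; have [w0 _ _] := wok.
rewrite /wint -ge0_integralD//.
- by apply: eq_integral => t _; rewrite -EFinD mulrDl.
- by move=> t /D0 t0; rewrite lee_fin mulr_ge0 ?p0 ?w0.
- exact: mphi.
- by move=> t /D0 t0; rewrite lee_fin mulr_ge0 ?q0 ?w0.
- exact: mphi.
Qed.

Lemma wint_eq phi psi : (forall t, 0 <= t -> phi t = psi t) -> wint phi = wint psi.
Proof.
by move=> pq; apply: eq_integral => t; rewrite inE => /D0 t0; rewrite pq.
Qed.

Lemma wint_le phi psi : (forall t, 0 <= t -> 0 <= phi t <= psi t) ->
  measurable_fun D phi -> measurable_fun D psi -> (wint phi <= wint psi)%E.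
Proof.
move=> pq mp mq; have [w0 _ _] := wok; apply: ge0_le_integral => //.
- by move=> t /D0 t0; rewrite lee_fin mulr_ge0 ?w0//; case/andP: (pq t t0).
- exact: mphi.
- exact: mphi.
- by move=> t /D0 t0; rewrite lee_fin ler_wpM2r ?w0//; case/andP: (pq t t0).
Qed.

Lemma wint_dominated (phi_ : nat -> R -> R) phi (c y : R) : 0 < y -> 0 <= c ->
  (forall n, measurable_fun D (phi_ n)) -> measurable_fun D phi ->
  (forall t, 0 <= t -> phi_ n t @[n --> \oo] --> phi t) ->
  (forall n t, 0 <= t -> 0 <= phi_ n t <= c * expR (- (y * t))) ->
  wint (phi_ n) @[n --> \oo] --> wint phi.
Proof.
move=> y0 c0 mp_ mp cv dom; have [w0 mw fw] := wok.
have ig : s.-integrable D (fun t => (expR (- (y * t)) * w t)%:E).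
  apply/integrableP; split; first by apply: mphi; exact: measurable_expRN.
  rewrite (eq_integral (fun t : measurableTypeR R => (expR (- (y * t)) * w t)%:E)); first exact: fw.
  by move=> t; rewrite inE => /D0 t0 /=; rewrite ger0_norm ?mulr_ge0 ?expR_ge0 ?w0.
apply: (@dominated_cvg _ _ _ s D mD _ _
  (fun t => c%:E * (expR (- (y * t)) * w t)%:E)%E).
- by move=> n; exact: mphi.
- move=> t /D0 t0; apply: cvg_EFin; first exact: nearW.
  by apply: cvgM; [exact: cv|exact: cvg_cst].
- by [].
- exact: integrableZl.
- move=> n t /D0 t0; have /andP[p0 pc] := dom n t t0.
  rewrite -EFinM lee_fin ger0_norm ?mulr_ge0 ?w0// mulrA.
  by rewrite ler_wpM2r ?w0.
Qed.

Let mle T : measurable_fun D (fun t : R => (t <= T)%R%:R : R).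
Proof.
rewrite [X in measurable_fun _ X](_ : _ =
  \1_(`]-oo, T]%classic : set (measurableTypeR R))); first exact: measurable_indic.
by apply/funext => t; rewrite indicE mem_setE in_itv.
Qed.

Let mlt T : measurable_fun D (fun t : R => (T < t)%R%:R : R).
Proof.
rewrite [X in measurable_fun _ X](_ : _ =
  \1_(`]T, +oo[%classic : set (measurableTypeR R))); first exact: measurable_indic.
by apply/funext => t; rewrite indicE mem_setE in_itv/= andbT.
Qed.

(** The powers approximate the indicator of t > T; the factor e^(-y t) keeps the integrals finite
    when the total mass is not. *)
Definition kint N x y :=
  wint (fun t => expR (- (y * t)) * (1 - expR (- (x * t))) ^+ N).

Let mk N x y :
  measurable_fun D (fun t => expR (- (y * t)) * (1 - expR (- (x * t))) ^+ N).
Proof.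
apply: measurable_funM; first exact: measurable_expRN.
apply: measurable_funX; apply: measurable_funB; first exact: measurable_cst.
exact: measurable_expRN.
Qed.

Let k01 x t : 0 <= x -> 0 <= t -> 0 <= 1 - expR (- (x * t)) <= 1.
Proof.
move=> x0 t0; rewrite subr_ge0 gerBl expR_ge0 andbT expR_le1 oppr_le0.
exact: mulr_ge0.
Qed.

Lemma kint_lty N x y : 0 <= x -> 0 < y -> (kint N x y < +oo)%E.
Proof.
move=> x0 y0; have [_ _ /(_ y y0)] := wok; apply: le_lt_trans.
apply: wint_le => // [t t0|]; last exact: measurable_expRN.
have /andP[k0 k1] := k01 x0 t0.
by rewrite mulr_ge0 ?expR_ge0 ?exprn_ge0//= ger_pMr ?expR_gt0// exprn_ile1.
Qed.

(* Iterating this in [N] expresses [kint] through the Laplace transform alone. *)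
Lemma kint_split N x y : 0 <= x ->
  (kint N x y = kint N.+1 x y + kint N x (y + x)%R)%E.
Proof.
move=> x0; rewrite /kint -wintD//; last 2 first.
- move=> t t0; have /andP[k0 k1] := k01 x0 t0.
  by rewrite mulr_ge0 ?expR_ge0 ?exprn_ge0.
- move=> t t0; have /andP[k0 k1] := k01 x0 t0.
  by rewrite mulr_ge0 ?expR_ge0 ?exprn_ge0.
apply: wint_eq => t t0.
have -> : - ((y + x) * t) = - (y * t) + - (x * t) by ring.
rewrite expRD exprS; ring.
Qed.

Lemma kint_cvg (T y : R) : 0 < T -> 0 < y ->
  kint (n * 2 ^ n) (n%:R * (ln 2 / T)) y @[n --> \oo] -->
  wint (fun t => expR (- (y * t)) * (T < t)%R%:R).
Proof.
move=> T0 y0; have l0 n : 0 <= n%:R * (ln 2 / T) :> R.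
  by rewrite mulr_ge0// divr_ge0 ?(ltW T0)// ltW// ln_gt0// ltr1n.
apply: (@wint_dominated _ _ 1 y) => //.
- apply: measurable_funM; first exact: measurable_expRN.
  exact: mlt.
- move=> t t0; apply: cvgM; first exact: cvg_cst.
  exact: threshold_cvg.
- move=> n t t0; have /andP[k0 k1] := k01 (l0 n) t0.
  by rewrite mulr_ge0 ?expR_ge0 ?exprn_ge0//= mul1r ger_pMr ?expR_gt0// exprn_ile1.
Qed.

Lemma wint_head_tail (T y : R) :
  wint (fun t => expR (- (y * t))) =
  (wint (fun t => expR (- (y * t)) * (T < t)%R%:R)%R +
   wint (fun t => expR (- (y * t)) * (t <= T)%R%:R)%R)%E.
Proof.
rewrite -wintD; first 1 last.
- by move=> t t0; rewrite mulr_ge0 ?expR_ge0.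
- by move=> t t0; rewrite mulr_ge0 ?expR_ge0.
- by apply: measurable_funM; [exact: measurable_expRN|exact: mlt].
- by apply: measurable_funM; [exact: measurable_expRN|exact: mle].
apply: wint_eq => t t0; rewrite -mulrDr.
by case: (lerP t T) => _; rewrite ?addr0 ?add0r mulr1.
Qed.

(** On [0, T] the damping can be removed: e^T e^(-t) >= 1 there, which dominates uniformly in n. *)
Lemma head_cvg (T : R) :
  wint (fun t => expR (- (n.+1%:R^-1 * t)) * (t <= T)%R%:R) @[n --> \oo] -->
  (\int[s]_(t in `[0%R, T]) (w t)%:E)%E.
Proof.
have -> : (\int[s]_(t in `[0%R, T]) (w t)%:E)%E = wint (fun t => (t <= T)%R%:R).
  rewrite /wint integral_mkcond [RHS]integral_mkcond; apply: eq_integral => t _.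
  rewrite !patchE !mem_setE !in_itv/= andbT.
  by case: (0 <= t) => //=; case: (t <= T); rewrite ?mul1r ?mul0r.
apply: (@wint_dominated _ _ (expR T) 1) => //.
- by move=> n; apply: measurable_funM; [exact: measurable_expRN|exact: mle].
- move=> t t0; rewrite -[X in _ --> X]mul1r; apply: cvgM; last exact: cvg_cst.
  have := cvg_comp _ _ (@cvg_harmonic R) (@continuous_expRN R t 0).
  rewrite mulr0 oppr0 expR0; apply: cvg_trans; apply: near_eq_cvg.
  by apply: nearW => n /=; rewrite mulrC.
- move=> n t t0; rewrite mulr_ge0 ?expR_ge0//=.
  case: (lerP t T) => tT; rewrite ?mulr0 ?mulr_ge0 ?expR_ge0//.
  rewrite mulr1 -expRD ler_expR mul1r (@le_trans _ _ 0)// ?subr_ge0//.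
  by rewrite oppr_le0 mulr_ge0.
Qed.

End weighted_laplace.

Section weighted_measure.
Context {R : realType}.
Variables (s : {measure set (measurableTypeR R) -> \bar R}) (w : R -> R).
Local Notation D := (`[0%R, +oo[%classic : set (measurableTypeR R)).

Lemma head_lty (T : R) : weight_ok s w -> (\int[s]_(t in `[0%R, T]) (w t)%:E < +oo)%E.
Proof.
move=> wok; have [w0 mw fw] := wok.
have mi : measurable (`[0%R, T]%classic : set (measurableTypeR R)).
  exact: measurable_itv.
have mD : measurable D by exact: measurable_itv.
have TD : `[0%R, T] `<=` D.
  by move=> t /=; rewrite !in_itv/= andbT => /andP[].
have me (A : set (measurableTypeR R)) : measurable A -> A `<=` D ->
    measurable_fun A (fun t => (expR T)%:E * (expR (- (1 * t)) * w t)%:E)%E.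
  move=> mA AD; apply: measurable_funeM; apply/measurable_EFinP/measurable_funM.
    exact: measurable_expRN.
  exact: measurable_funS mw.
have D0 t : D t -> 0 <= t by rewrite /= in_itv/= andbT.
apply: (@le_lt_trans _ _
    (\int[s]_(t in D) ((expR T)%:E * (expR (- (1 * t)) * w t)%:E))%E).
  apply: (@le_trans _ _
    (\int[s]_(t in `[0%R, T]) ((expR T)%:E * (expR (- (1 * t)) * w t)%:E))%E).
    apply: ge0_le_integral => //.
    - by move=> t /TD/D0 t0; rewrite lee_fin w0.
    - apply/measurable_EFinP; exact: measurable_funS mw.
    - exact: me.
    - move=> t tT; have t0 := D0 t (TD t tT).
      move: tT; rewrite /= in_itv/= => /andP[_ tT].
      rewrite -EFinM lee_fin mulrA -expRD ler_peMl ?w0//.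
      have : expR 0 <= expR (T + - (1 * t)) by rewrite ler_expR mul1r subr_ge0.
      by rewrite expR0.
  apply: ge0_subset_integral => //; first exact: me.
  by move=> t /D0 t0; rewrite -EFinM lee_fin !mulr_ge0 ?expR_ge0 ?w0.
rewrite ge0_integralZl_EFin ?expR_ge0//.
- by rewrite lte_mul_pinfty ?lee_fin ?expR_ge0//; exact: fw.
- by move=> t /D0 t0; rewrite lee_fin mulr_ge0 ?expR_ge0 ?w0.
- by apply/measurable_EFinP/measurable_funM => //; exact: measurable_expRN.
Qed.

(** Turns w ds into a measure, to which the uniqueness theorem for measures agreeing on a pi-system
    applies. *)
Lemma weighted_measure : (forall t, 0 <= t -> 0 <= w t) -> measurable_fun D w ->
  exists m : {measure set (measurableTypeR R) -> \bar R},
    forall A, m A = (\int[s]_(t in A `&` D) (w t)%:E)%E.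
Proof.
move=> w0 mw; have mD : measurable D by exact: measurable_itv.
have D0 t : D t -> 0 <= t by rewrite /= in_itv/= andbT.
pose m (A : set (measurableTypeR R)) := (\int[s]_(t in A `&` D) (w t)%:E)%E.
have m0 : m set0 = 0%E by rewrite /m set0I integral_set0.
have mge0 A : (0 <= m A)%E.
  by apply: integral_ge0 => t [_ /D0 t0]; rewrite lee_fin w0.
have madd : semi_sigma_additive m.
  move=> /= F mF tF mUF; rewrite /m setI_bigcupl; apply: cvg_toP.
    apply: ereal_nondecreasing_is_cvgn => i j ij.
    by apply: lee_sum_nneg_natr => // k _ _; exact: mge0.
  rewrite ge0_integral_bigcup//.
  - by move=> n; exact: measurableI.
  - by apply/measurable_EFinP; apply: measurable_funS mw => // t [n _ []].
  - by move=> t [n _ [_ /D0 t0]]; rewrite lee_fin w0.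
  - exact: trivIset_setIr.
pose mm : {measure set (measurableTypeR R) -> \bar R} :=
  HB.pack m (isMeasure.Build _ _ _ m m0 mge0 madd).
by exists mm.
Qed.

End weighted_measure.

(** * Uniqueness for a sum of weighted measures *)

Section laplace_uniqueness.
Context {R : realType}.
Variables (s1 s2 s3 : {measure set (measurableTypeR R) -> \bar R}).
Variables (w1 w2 w3 : R -> R).
Hypotheses (ok1 : weight_ok s1 w1) (ok2 : weight_ok s2 w2)
  (ok3 : weight_ok s3 w3).
Local Notation D := (`[0%R, +oo[%classic : set (measurableTypeR R)).
Hypothesis eq_laplace : forall x, 0 < x ->
  (wint s1 w1 (fun t => expR (- (x * t)))%R =
   wint s2 w2 (fun t => expR (- (x * t)))%R +
   wint s3 w3 (fun t => expR (- (x * t)))%R)%E.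

Let kint_ge0 (s : {measure set (measurableTypeR R) -> \bar R}) (w : R -> R) N x y :
  weight_ok s w -> 0 <= x -> (0 <= kint s w N x y)%E.
Proof.
move=> ok x0; apply: wint_ge0 => // t t0; rewrite mulr_ge0 ?expR_ge0//.
by rewrite exprn_ge0// subr_ge0 expR_le1 oppr_le0 mulr_ge0.
Qed.

(** Finiteness of the left-hand side propagates through the equation, so all six nonnegative terms
    are real and subtraction is legitimate. *)
Let cancel_eq (a1 a2 a3 b1 b2 b3 : \bar R) :
  [/\ 0 <= a1, 0 <= a2 & 0 <= a3]%E -> [/\ 0 <= b1, 0 <= b2 & 0 <= b3]%E ->
  (a1 + b1 < +oo -> a1 + b1 = (a2 + b2) + (a3 + b3) -> b1 = b2 + b3 ->
  a1 = a2 + a3)%E.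
Proof.
move: a1 a2 a3 b1 b2 b3 => [a1||] [a2||] [a3||] [b1||] [b2||] [b3||] //=;
  try (by move=> [] //); try (by move=> _ []).
by move=> _ _ _ [h1] [h2]; congr EFin; lra.
Qed.

Let kint_eq N x y : 0 <= x -> 0 < y ->
  (kint s1 w1 N x y = kint s2 w2 N x y + kint s3 w3 N x y)%E.
Proof.
elim: N y => [|N IH] y x0 y0.
  have E (s : {measure set (measurableTypeR R) -> \bar R}) (w : R -> R) :
    kint s w 0 x y = wint s w (fun t => expR (- (y * t))).
    by apply: wint_eq => t _; rewrite expr0 mulr1.
  by rewrite !E eq_laplace.
apply: (cancel_eq (b1 := kint s1 w1 N x (y + x)) (b2 := kint s2 w2 N x (y + x))
  (b3 := kint s3 w3 N x (y + x))).
- by split; exact: kint_ge0.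
- by split; exact: kint_ge0.
- by rewrite -kint_split//; exact: kint_lty.
- by rewrite -!kint_split// IH.
- by rewrite IH// ltr_wpDr.
Qed.

Let tail_eq (T y : R) : 0 < T -> 0 < y ->
  (wint s1 w1 (fun t => expR (- (y * t)) * (T < t)%R%:R)%R =
   wint s2 w2 (fun t => expR (- (y * t)) * (T < t)%R%:R)%R +
   wint s3 w3 (fun t => expR (- (y * t)) * (T < t)%R%:R)%R)%E.
Proof.
move=> T0 y0; have l0 n : 0 <= n%:R * (ln 2 / T) :> R.
  by rewrite mulr_ge0// divr_ge0 ?(ltW T0)// ltW// ln_gt0// ltr1n.
have ad : (wint s2 w2 (fun t => expR (- (y * t)) * (T < t)%R%:R)%R +?
    wint s3 w3 (fun t => expR (- (y * t)) * (T < t)%R%:R)%R)%E.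
  by apply: ge0_adde_def; rewrite inE; apply: wint_ge0 => // t t0;
    rewrite mulr_ge0 ?expR_ge0.
apply: (cvg_unique _ (kint_cvg ok1 T0 y0)) => //.
apply: cvg_trans (cvgeD ad (kint_cvg ok2 T0 y0) (kint_cvg ok3 T0 y0)).
by apply: near_eq_cvg; apply: nearW => n /=; rewrite kint_eq.
Qed.

(** The damped tails agree, so subtracting them from the full transforms leaves the damped heads;
    only then does the damping y = 1 / (n + 1) tend to 0, since an undamped tail may have infinite
    mass. *)
Let head_eq (T : R) : 0 < T ->
  (\int[s1]_(t in `[0%R, T]) (w1 t)%:E =
   \int[s2]_(t in `[0%R, T]) (w2 t)%:E + \int[s3]_(t in `[0%R, T]) (w3 t)%:E)%E.
Proof.
move=> T0.
have h0 (s : {measure set (measurableTypeR R) -> \bar R}) (w : R -> R) y :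
    weight_ok s w -> (0 <= wint s w (fun t => expR (- (y * t)) * (t <= T)%R%:R)%R)%E.
  by move=> ok; apply: wint_ge0 => // t t0; rewrite mulr_ge0 ?expR_ge0.
have t0 (s : {measure set (measurableTypeR R) -> \bar R}) (w : R -> R) y :
    weight_ok s w -> (0 <= wint s w (fun t => expR (- (y * t)) * (T < t)%R%:R)%R)%E.
  by move=> ok; apply: wint_ge0 => // t t0; rewrite mulr_ge0 ?expR_ge0.
have E n : (wint s1 w1 (fun t => expR (- (n.+1%:R^-1 * t)) * (t <= T)%R%:R)%R =
   wint s2 w2 (fun t => expR (- (n.+1%:R^-1 * t)) * (t <= T)%R%:R)%R +
   wint s3 w3 (fun t => expR (- (n.+1%:R^-1 * t)) * (t <= T)%R%:R)%R)%E.
  have n0 : 0 < n.+1%:R^-1 :> R by rewrite invr_gt0.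
  have := eq_laplace n0; have [_ _ /(_ _ n0)] := ok1.
  rewrite (wint_head_tail ok1 T) (wint_head_tail ok2 T) (wint_head_tail ok3 T).
  rewrite addeC [X in (_ = X + _ -> _)%E]addeC [X in (_ = _ + X -> _)%E]addeC.
  move=> fin eq; apply: (cancel_eq _ _ fin eq (tail_eq T0 n0)).
  - by split; exact: h0.
  - by split; exact: t0.
have ad : (\int[s2]_(t in `[0%R, T]) (w2 t)%:E +?
    \int[s3]_(t in `[0%R, T]) (w3 t)%:E)%E.
  have i0 (s : {measure set (measurableTypeR R) -> \bar R}) (w : R -> R) :
      weight_ok s w -> (0 <= \int[s]_(t in `[0%R, T]) (w t)%:E)%E.
    move=> [w0 _ _]; apply: integral_ge0 => t; rewrite /= in_itv/= lee_fin.
    by move=> /andP[t0' _]; exact: w0.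
  by apply: ge0_adde_def; rewrite inE; exact: i0.
apply: (cvg_unique _ (head_cvg ok1 (T := T))) => //.
apply: cvg_trans (cvgeD ad (head_cvg ok2 (T := T)) (head_cvg ok3 (T := T))).
by apply: near_eq_cvg; apply: nearW => n /=; rewrite E.
Qed.

Lemma laplace_unique (B : set (measurableTypeR R)) : measurable B ->
  B `<=` `[0%R, +oo[ ->
  (\int[s1]_(t in B) (w1 t)%:E =
   \int[s2]_(t in B) (w2 t)%:E + \int[s3]_(t in B) (w3 t)%:E)%E.
Proof.
move=> mB BD.
have [w10 mw1 _] := ok1; have [w20 mw2 _] := ok2; have [w30 mw3 _] := ok3.
have [m1 m1E] := weighted_measure s1 w10 mw1.
have [m2 m2E] := weighted_measure s2 w20 mw2.
have [m3 m3E] := weighted_measure s3 w30 mw3.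
pose m23 : {measure set (measurableTypeR R) -> \bar R} := measure_add m2 m3.
have m23E A : m23 A = (m2 A + m3 A)%E by exact: measure_addE.
have oc T : 0 < T -> m1 `]-oo, T]%classic = m23 `]-oo, T]%classic.
  move=> T0; rewrite m23E m1E m2E m3E.
  rewrite (_ : `]-oo, T] `&` D = `[0%R, T]%classic); first exact: head_eq.
  apply/seteqP; split => t /=; rewrite !in_itv/= andbT.
    by move=> [-> ->].
  by move=> /andP[-> ->].
have fin T : 0 < T -> (m1 `]-oo, T]%classic < +oo)%E.
  move=> T0; rewrite m1E (_ : `]-oo, T] `&` D = `[0%R, T]%classic).
    exact: head_lty.
  apply/seteqP; split => t /=; rewrite !in_itv/= andbT.
    by move=> [-> ->].
  by move=> /andP[-> ->].
suff : m1 B = m23 B by rewrite m23E m1E m2E m3E setIidl.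
apply: (@measure_unique _ R (measurableTypeR R) (@RGenInftyO.G R)
   (fun n => `]-oo, n.+1%:R[%classic)) => //.
- exact: RGenInftyO.measurableE.
- move=> _ _ [x ->] [y ->]; exists (Num.min x y).
  apply/seteqP; split => t /=; rewrite !in_itv/= lt_min; first by move=> [-> ->].
  by move=> /andP[].
- by move=> n; exists n.+1%:R.
- apply/seteqP; split => // t _; exists (Num.truncn `|t|) => //=.
  by rewrite in_itv/= (le_lt_trans (ler_norm t))// truncnS_gt.
- move=> _ [x ->]; have [x0|x0] := lerP x 0.
    have E0 : `]-oo, x[ `&` D = set0.
      apply/seteqP; split => // t /=; rewrite !in_itv/= andbT => -[tx].
      by rewrite leNgt (lt_le_trans tx).
    by rewrite m23E m1E m2E m3E E0 !integral_set0 adde0.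
  (* Closed half-lines increasing to the open one; [n.+2] keeps T n positive already at n = 0, as
     [head_eq] demands. *)
  pose T n : R := x - x / n.+2%:R.
  have T0 n : 0 < T n.
    by rewrite subr_gt0 ltr_pdivrMr// ltr_pMr// ltr1n.
  have TE : `]-oo, x[%classic = \bigcup_n `]-oo, T n]%classic.
    apply/seteqP; split => t /=; rewrite in_itv/=.
      move=> tx; have xt0 : 0 < x - t by rewrite subr_gt0.
      exists (Num.truncn (x / (x - t))) => //=; rewrite in_itv/= lerBrDl -lerBrDr.
      rewrite ler_pdivrMr// mulrC -ler_pdivrMr//.
      by apply: le_trans (ltW (truncnS_gt _)) _; rewrite ler_nat.
    move=> [n _]; rewrite /= in_itv/= => /le_lt_trans; apply.
    by rewrite ltrBlDr ltrDl divr_gt0.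
  have mT n : measurable (`]-oo, T n]%classic : set (measurableTypeR R)).
    exact: measurable_itv.
  have mU : measurable (\bigcup_n `]-oo, T n]%classic : set (measurableTypeR R)).
    exact: bigcupT_measurable.
  have ndT : nondecreasing_seq (fun n => `]-oo, T n]%classic).
    move=> n m nm; apply/subsetPset => t /=; rewrite !in_itv/= => /le_trans; apply.
    rewrite lerD2l lerN2 ler_pM2l// lef_pV2 ?posrE//.
    by rewrite ler_nat !ltnS.
  rewrite TE.
  apply: (cvg_unique _ (nondecreasing_cvg_mu (mu := m1) mT mU ndT)) => //.
  apply: cvg_trans (nondecreasing_cvg_mu (mu := m23) mT mU ndT).
  by apply: near_eq_cvg; apply: nearW => n /=; rewrite oc.
- move=> n; apply: le_lt_trans (fin n.+1%:R _) => //.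
  apply: le_measure; rewrite ?inE; [exact: measurable_itv|exact: measurable_itv|].
  by move=> t /=; rewrite !in_itv/=; exact: ltW.
Qed.

End laplace_uniqueness.

(** * Differentiation of a Laplace transform *)

Section laplace_derivative.
Context {R : realType}.
Variables (s : {measure set (measurableTypeR R) -> \bar R}) (g : R -> R).
Local Notation D := (`[0%R, +oo[%classic : set (measurableTypeR R)).
Hypothesis sg : forall x, 0 < x ->
  (\int[s]_(t in `[0%R, +oo[) (expR (- (x * t)))%:E = (g x)%:E)%E.

Lemma laplace_integrable (x : R) : 0 < x ->
  s.-integrable D (fun t => (expR (- (x * t)))%:E).
Proof.
move=> x0; apply/integrableP; split.
  by apply/measurable_EFinP; exact: measurable_expRN.
rewrite (eq_integral (fun t : measurableTypeR R => (expR (- (x * t)))%:E)).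
  by rewrite sg// ltry.
by move=> t _ /=; rewrite ger0_norm ?expR_ge0.
Qed.

Lemma mulr_expRN_le (y t : R) : 0 < y -> 0 <= t ->
  t * expR (- (y *+ 2 * t)) <= y^-1 * expR (- (y * t)).
Proof.
move=> y0 t0; have -> : - (y *+ 2 * t) = - (y * t) + - (y * t) by ring.
rewrite expRD mulrA ler_wpM2r ?expR_ge0// expRN ler_pdivrMr ?expR_gt0//.
rewrite mulrC ler_pdivlMr//; apply: le_trans (expR_ge1Dx _).
by rewrite mulrC lerDr.
Qed.

Lemma laplace_derive1 (x : R) : 0 < x ->
  wint s id (fun t => expR (- (x * t))) = (- g^`() x)%:E.
Proof.
move=> x0; pose f (z t : R) := expR (- (t * z)).
have mD : measurable D by exact: measurable_itv.
have x40 : 0 < x / 4 by rewrite divr_gt0.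
(* For z > x / 2 the derivative is at most t e^(-x t / 2), and half of this exponent absorbs the
   factor t: [mulr_expRN_le] at y = x / 4. *)
pose G (t : R) := (x / 4)^-1 * expR (- (x / 4 * t)).
have fE z : (fun t => (f z t)%:E) = (fun t => (expR (- (z * t)))%:E).
  by apply/funext => t; rewrite /f mulrC.
have Df (z t : R) : is_derive z 1 (f ^~ t) (- t * expR (- (t * z))).
  exact: is_derive_expRN.
have d1f z t : partial1of2 f z t = - t * expR (- (t * z)).
  exact: is_derive_derive1.
have Ix : `]x / 2, x *+ 2[%classic x by rewrite /= in_itv/=; apply/andP; split; lra.
have iG : s.-integrable D (EFin \o G).
  have -> : EFin \o G = (fun t => ((x / 4)^-1)%:E * (expR (- (x / 4 * t)))%:E)%E.
    by [].
  exact/integrableZl/laplace_integrable.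
have intf z : `]x / 2, x *+ 2[%classic z -> s.-integrable D (EFin \o f z).
  rewrite /= in_itv/= => /andP[xz _]; rewrite /comp fE.
  by apply: laplace_integrable; rewrite (lt_trans _ xz)// divr_gt0.
have bd z t : `]x / 2, x *+ 2[%classic z -> D t -> `|partial1of2 f z t| <= G t.
  rewrite /= !in_itv/= andbT => /andP[xz _] t0.
  rewrite d1f normrM normrN (ger0_norm t0) (ger0_norm (expR_ge0 _)).
  apply: le_trans (mulr_expRN_le x40 t0).
  rewrite ler_wpM2l// ler_expR lerN2 [leRHS]mulrC ler_wpM2r//.
  by rewrite mulr2n; lra.
have G0 t : 0 <= G t by rewrite mulr_ge0 ?invr_ge0 ?expR_ge0// ltW.
have := @differentiation_under_integral R _ _ s f D mD x (x / 2) (x *+ 2) Ix intf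
  (fun z t _ _ => @ex_derive _ _ _ _ _ _ _ (Df z t)) G G0 iG bd.
rewrite (@derive1_eq_pos _ _ g)//; last first.
  by move=> y y0; rewrite /Rintegral fE sg.
move=> ->.
have mx : measurable_fun D (fun t => (expR (- (x * t)) * t)%:E).
  apply/measurable_EFinP/measurable_funM; first exact: measurable_expRN.
  exact: measurable_id.
have iw : s.-integrable D (fun t => (expR (- (x * t)) * t)%:E).
  apply: le_integrable iG => // t Dt; rewrite /= lee_fin.
  rewrite (ger0_norm (G0 t)); apply: le_trans (bd x t Ix Dt).
  by rewrite d1f mulNr normrN mulrC [x * t]mulrC.
rewrite /wint /Rintegral (eq_integral (fun t : measurableTypeR R => - (expR (- (x * t)) * t)%:E)%E).
  rewrite integral_ge0N; last first.
    move=> t; rewrite /= in_itv/= andbT => t0.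
    by rewrite lee_fin mulr_ge0 ?expR_ge0.
  by rewrite fineN opprK fineK//; exact: integrable_fin_num.
by move=> t _; rewrite d1f mulNr mulrC [x * t]mulrC.
Qed.

End laplace_derivative.

(** * Right derivatives *)

Section right_derivatives.
Context {R : realType}.
Implicit Types (f g : R -> R) (t l : R).

Lemma cvg_at_right_shift f t l : f x @[x --> t^'+] --> l ->
  f (t + h) @[h --> 0^'+] --> l.
Proof.
move=> /cvgrPdist_lt fl; apply/cvgrPdist_lt => e /fl.
rewrite !near_withinE => /nbhs_ballP[d /= d0 dP].
apply/nbhs_ballP; exists d => //= h; rewrite /ball/= sub0r normrN => hd h0.
by apply: dP; rewrite /ball/= ?opprD ?addrA ?subrr ?sub0r ?normrN// ltrDl.
Qed.

Definition is_rderive g t l := h^-1 * (g (t + h) - g t) @[h --> 0^'+] --> l.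

Lemma is_rderive_derivable g t l : is_rderive g t l -> derivable_right g t.
Proof. by move=> gl; apply/cvg_ex; exists l. Qed.

Lemma is_rderive_val g t l : is_rderive g t l -> derive_right g t = l.
Proof. by move=> gl; apply/cvg_lim. Qed.

Lemma is_derive_rderive g t l : is_derive t 1 g l -> is_rderive g t l.
Proof.
move=> [dg <-].
have C : h^-1 *: ((g \o shift t) (h *: 1) - g t) @[h --> 0^'] --> 'D_1 g t.
  exact: dg.
have := cvg_dnbhs_at_right C.
apply: cvg_trans; apply: near_eq_cvg; apply: nearW => h.
by rewrite /= /GRing.scale /= mulr1 [h + t]addrC.
Qed.

Lemma is_rderive_cvg g t l : is_rderive g t l -> g (t + h) @[h --> 0^'+] --> g t.
Proof.
move=> gl; have C : h * (h^-1 * (g (t + h) - g t)) + g t @[h --> 0^'+] --> 0 * l + g t.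
  apply: cvgD; last exact: cvg_cst.
  by apply: cvgM => //; apply: cvg_at_right_filter; exact: cvg_id.
move: C; rewrite mul0r add0r; apply: cvg_trans; apply: near_eq_cvg.
near=> h; rewrite mulrA divff ?mul1r ?subrK// gt_eqF//.
Unshelve. all: by end_near. Qed.

Lemma is_rderive_eq_pos f g t l : (forall s, 0 < s -> f s = g s) -> 0 < t ->
  is_rderive f t l -> is_rderive g t l.
Proof.
move=> fg t0; apply: cvg_trans; apply: near_eq_cvg; near=> h.
have h0 : 0 < h by [].
by rewrite !fg// addr_gt0.
Unshelve. all: by end_near. Qed.

Lemma is_rderiveM f g t (df dg : R) : is_rderive f t df -> is_rderive g t dg ->
  is_rderive (fun s => f s * g s) t (df * g t + f t * dg).
Proof.
move=> Df Dg.
have C : h^-1 * (f (t + h) - f t) * g (t + h) + f t * (h^-1 * (g (t + h) - g t))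
    @[h --> 0^'+] --> df * g t + f t * dg.
  apply: cvgD; apply: cvgM => //; [exact: is_rderive_cvg Dg|exact: cvg_cst].
apply: cvg_trans C; apply: near_eq_cvg; apply: nearW => h; ring.
Qed.

End right_derivatives.

(** * Primitives of nondecreasing functions *)

Section monotone_integrand.
Context {R : realType}.
Variables (G r : R -> R).
Local Notation leb := (@lebesgue_measure R).
Hypothesis ndr : {homo r : s t / s <= t}.
Hypothesis r0 : forall t, 0 <= r t.
Hypothesis GE : forall t, 0 <= t ->
  ((G t)%:E = \int[leb]_(s in `[0%R, t]) (r s)%:E)%E.

(** On ]a, b] the integrand lies between its endpoint values. One-sided continuity of r then yields
    a one-sided derivative of G, and continuity the full derivative. *)
Lemma increment_bounds a b : 0 <= a -> a <= b ->
  (b - a) * r a <= G b - G a <= (b - a) * r b.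
Proof.
move=> a0 ab; have b0 := le_trans a0 ab.
have mr (A : set (measurableTypeR R)) : measurable A ->
    measurable_fun A (fun s => (r s)%:E).
  by move=> mA; apply/measurable_EFinP; exact: nondecreasing_measurable.
have mab : measurable (`]a, b]%classic : set (measurableTypeR R)).
  exact: measurable_itv.
have E : (\int[leb]_(s in `]a, b]) (r s)%:E = (G b - G a)%:E)%E.
  have := GE b0; rewrite (@itv_bndbnd_setU _ _ (BLeft 0) (BRight a) (BRight b));
    rewrite ?bnd_simp//.
  rewrite ge0_integral_setU//=; last 3 first.
  - by apply: mr; apply: measurableU; exact: measurable_itv.
  - by move=> s _; rewrite lee_fin.
  - apply/disj_setPS => s [/=]; rewrite !in_itv/= => /andP[_ sa] /andP[].
    by rewrite ltNge sa.
  by rewrite -GE// => GbE; rewrite EFinB GbE [X in (_ = X - _)%E]addeC addeK.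
have L c : (\int[leb]_(s in `]a, b]) c%:E = ((b - a) * c)%:E)%E.
  rewrite integral_cst//= lebesgue_measure_itv/= lte_fin.
  case: ltP => [_|ba]; first by rewrite -EFinB -EFinM mulrC.
  have -> : a = b by apply/eqP; rewrite eq_le ab ba.
  by rewrite subrr mul0r mule0.
apply/andP; split; rewrite -lee_fin -E -L; apply: ge0_le_integral => //.
- by move=> s _; rewrite lee_fin.
- exact: mr.
- by move=> s; rewrite /= in_itv/= lee_fin => /andP[/ltW/ndr].
- by move=> s _; rewrite lee_fin.
- exact: mr.
- by move=> s; rewrite /= in_itv/= lee_fin => /andP[_ /ndr].
Qed.

Lemma increment_rderive t : 0 <= t -> r x @[x --> t^'+] --> r t ->
  is_rderive G t (r t).
Proof.
move=> t0 rt.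
apply: (@squeeze_cvgr _ _ _ _ (cst (r t)) (fun h => r (t + h))).
- near=> h; have h0 : 0 < h by [].
  have := @increment_bounds t (t + h) t0 _.
  rewrite lerDl ltW// => /(_ isT); rewrite addrAC subrr add0r => /andP[h1 h2].
  by rewrite /cst mulrC ler_pdivlMr// ler_pdivrMr// [r t * h]mulrC h1 [r _ * h]mulrC h2.
- exact: cvg_cst.
- exact: cvg_at_right_shift.
Unshelve. all: by end_near. Qed.

Lemma increment_derive t : 0 < t -> {for t, continuous r} ->
  is_derive t 1 G (r t).
Proof.
move=> t0 rt.
have C : h^-1 *: ((G \o shift t) (h *: 1) - G t) @[h --> 0^'] --> r t.
  apply/cvgrPdist_le => e e0; move/cvgrPdist_le : rt => /(_ e e0).
  move=> /nbhs_ballP[d /= d0 dP]; rewrite near_withinE.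
  (* Keeping |h| below t ensures t + h >= 0, where G is given by the integral. *)
  have dt0 : 0 < Num.min d t by rewrite lt_min d0.
  apply/nbhs_ballP; exists (Num.min d t) => //= h.
  rewrite /ball/= sub0r normrN lt_min => /andP[hd ht] h0.
  have rh : `|r t - r (t + h)| <= e.
    by apply: dP; rewrite /ball/= opprD addrA subrr sub0r normrN.
  have th0 : 0 <= t + h by move: ht; rewrite ltr_norml => /andP[]; lra.
  apply: le_trans rh; rewrite /GRing.scale /= mulr1 [h + t]addrC.
  move: h0; rewrite neq_lt => /orP[h0|h0].
    have tht : t + h <= t by rewrite gerDl ltW.
    have := increment_bounds th0 tht; rewrite opprD addrA subrr sub0r.
    set Q := h^-1 * _.
    have -> : G t - G (t + h) = - h * Q by rewrite /Q; field; rewrite lt_eqF.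
    have hN0 : 0 < - h by rewrite oppr_gt0.
    rewrite !ler_pM2l// => /andP[q1 q2].
    by rewrite !ger0_norm ?subr_ge0 ?ndr//; lra.
  have tht : t <= t + h by rewrite lerDl ltW.
  have := increment_bounds (ltW t0) tht; rewrite addrAC subrr add0r.
  set Q := h^-1 * _.
  have -> : G (t + h) - G t = h * Q by rewrite /Q; field; rewrite gt_eqF.
  rewrite !ler_pM2l// => /andP[q1 q2].
  by rewrite !ler0_norm ?subr_le0 ?ndr//; lra.
by apply: DeriveDef; [apply/cvg_ex; exists (r t)|exact/cvg_lim].
Qed.

(** Near t the integrand is at most r(t + 1), so G is Lipschitz there, even across a jump of r. *)
Lemma increment_continuous t : 0 < t -> {for t, continuous G}.
Proof.
move=> t0.
have D : `|s - t| * r (t + 1) @[s --> t] --> 0.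
  have C : `|s - t| * r (t + 1) @[s --> t] --> `|t - t| * r (t + 1).
    apply: cvgM; last exact: cvg_cst.
    by apply: cvg_norm; apply: cvgB; [exact: cvg_id|exact: cvg_cst].
  by move: C; rewrite subrr normr0 mul0r.
apply/cvgrPdist_le => e e0.
move/cvgr0Pnorm_le : D => /(_ e e0); apply: filter_app; near=> s.
have s0 : 0 < s by near: s; exact: lt_nbhsr.
have st1 : s <= t + 1 by apply/ltW; near: s; apply: lt_nbhsl; rewrite ltrDl.
rewrite normrM !normr_id (ger0_norm (r0 _)); apply: le_trans.
have [st|ts] := lerP s t.
  have /andP[h1 h2] := increment_bounds (ltW s0) st.
  rewrite ger0_norm; last by apply: le_trans h1; rewrite mulr_ge0// subr_ge0.
  apply: le_trans h2 _.
  by rewrite ler_wpM2l ?subr_ge0// ndr// lerDl.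
have /andP[h1 h2] := increment_bounds (ltW t0) (ltW ts).
rewrite distrC ger0_norm; last by apply: le_trans h1; rewrite mulr_ge0// subr_ge0 ltW.
apply: le_trans h2 _.
by rewrite ler_wpM2l ?subr_ge0 ?(ltW ts)// ndr.
Unshelve. all: by end_near. Qed.

End monotone_integrand.

(** * Derivatives of p = q_0 from the relations between consecutive q_j *)

Section ladder.
Context {R : realType}.
Local Notation leb := (@lebesgue_measure R).
Variables (k : nat) (q : nat -> R -> R).
Hypothesis ndq : forall j, (j < k)%N -> {homo q j : s t / s <= t}.
Hypothesis rcq : forall j t, (j < k)%N -> q j x @[x --> t^'+] --> q j t.
Hypothesis q_ge0 : forall j t, (j < k)%N -> 0 <= q j t.
Hypothesis q_step : forall j t, (j.+1 < k)%N -> 0 <= t ->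
  ((t * q j t)%:E =
   \int[leb]_(s in `[0%R, t]) (q j.+1 s + j.+1%:R * q j s)%:E)%E.

Implicit Types (j : nat) (s t : R).

Let r j s := q j.+1 s + j.+1%:R * q j s.

Let jk j : (j.+1 < k)%N -> (j < k)%N. Proof. exact: ltnW. Qed.

Let ndr j : (j.+1 < k)%N -> {homo r j : s t / s <= t}.
Proof.
move=> jk1 s t st; rewrite /r lerD ?ndq// ler_wpM2l//.
by apply: ndq => //; exact: jk.
Qed.

Let r_ge0 j s : (j.+1 < k)%N -> 0 <= r j s.
Proof. move=> jk1; apply: addr_ge0; first exact: q_ge0.
by apply: mulr_ge0; [exact: ler0n|apply: q_ge0; exact: jk].
Qed.

Lemma mulX_q_rderive j t : (j.+1 < k)%N -> 0 <= t ->
  is_rderive (fun s => s * q j s) t (q j.+1 t + j.+1%:R * q j t).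
Proof.
move=> jk1 t0.
apply: (increment_rderive (r := r j)) => //.
- exact: ndr.
- by move=> s; exact: r_ge0.
- by move=> s s0; exact: q_step.
- apply: cvgD; first exact: rcq.
  by apply: cvgM; [exact: cvg_cst|apply: rcq; exact: jk].
Qed.

(** Each q_j below the top is a continuous integral divided by t. The argument says nothing of
    q_(k-1), which has no successor. *)
Lemma q_continuous j t : (j.+1 < k)%N -> 0 < t -> {for t, continuous (q j)}.
Proof.
move=> jk1 t0.
have cG : {for t, continuous (fun s : R => s * q j s)}.
  apply: (increment_continuous (r := r j)) => //.
  - exact: ndr.
  - by move=> s; exact: r_ge0.
  - by move=> s s0; exact: q_step.
have C : (s : R)^-1 * (s * q j s) @[s --> t] --> t^-1 * (t * q j t).
  by apply: cvgM => //; apply: cvgV; [rewrite gt_eqF|exact: cvg_id].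
move: C; rewrite mulKf ?gt_eqF//; apply: cvg_trans; apply: near_eq_cvg.
have : \forall s \near t, 0 < s by exact: lt_nbhsr.
by apply: filterS => s s0; rewrite mulKf ?gt_eqF.
Qed.

(** Continuity of q_(j+1) is a genuine condition when j + 1 = k - 1; for smaller j it comes from
    [q_continuous]. *)
Lemma mulX_q_derive j t : (j.+1 < k)%N -> 0 < t ->
  {for t, continuous (q j.+1)} ->
  is_derive t 1 (fun s => s * q j s) (q j.+1 t + j.+1%:R * q j t).
Proof.
move=> jk1 t0 cq.
apply: (increment_derive (r := r j)) => //.
- exact: ndr.
- by move=> s; exact: r_ge0.
- by move=> s s0; exact: q_step.
- by apply: cvgD => //; apply: cvgM; [exact: cvg_cst|exact: q_continuous].
Qed.

(** The right derivative of t q_j at 0 is q_j(0), by right continuity, and also q_(j+1)(0) + (j + 1)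
    q_j(0). Hence q_(j+1)(0) + j q_j(0) = 0 with both terms nonnegative. For the measures this means
    that only sigma_0 can charge the origin. *)
Lemma q_at0 j : (0 < j < k)%N -> q j 0 = 0.
Proof.
case: j => // j jk1.
have D := mulX_q_rderive jk1 (lexx 0).
have C : h^-1 * ((0 + h) * q j (0 + h) - 0 * q j 0) @[h --> 0^'+] --> q j 0.
  have := cvg_at_right_shift (rcq (t := 0) (jk jk1)).
  apply: cvg_trans; apply: near_eq_cvg; near=> h.
  have h0 : 0 < h by [].
  by rewrite !add0r mul0r subr0 mulKf ?gt_eqF.
have E : q j.+1 0 + j.+1%:R * q j 0 = q j 0 by apply: (cvg_unique _ D C).
have := q_ge0 0 jk1; have : 0 <= j%:R * q j 0.
  by apply: mulr_ge0; [exact: ler0n|apply: q_ge0; exact: jk].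
move: E; rewrite -natr1; lra.
Unshelve. all: by end_near. Qed.

Let is_derive_invX n (t : R) : 0 < t ->
  is_derive t 1 (fun s : R => (s ^+ n.+1)^-1) (- (n.+1%:R * (t ^+ n.+2)^-1)).
Proof.
move=> t0; have tn0 m : t ^+ m != 0 by rewrite expf_neq0// gt_eqF.
have := is_deriveV (f := fun y : R => y ^+ n.+1) (tn0 n.+1) (is_derive_Xn n.+1 t).
move/is_derive_eq; apply; rewrite /GRing.scale /= !exprS.
move: (t ^+ n) (tn0 n) (n.+1%:R : R) => y y0 c.
by field; rewrite y0 gt_eqF.
Qed.

Let quotE j (s : R) : 0 < s -> (s * q j s) * (s ^+ j.+1)^-1 = q j s / s ^+ j.
Proof.
by move=> s0; rewrite exprS; field; rewrite expf_neq0 ?gt_eqF.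
Qed.

Let quot_derE j (t : R) : 0 < t ->
  (q j.+1 t + j.+1%:R * q j t) * (t ^+ j.+1)^-1 +
  t * q j t * - (j.+1%:R * (t ^+ j.+2)^-1) = q j.+1 t / t ^+ j.+1.
Proof.
move=> t0; have y0 : t ^+ j.+1 != 0 by rewrite expf_neq0 ?gt_eqF.
by rewrite (exprS t j.+1); field; rewrite y0 gt_eqF.
Qed.

(** In q_j / t^j = (t q_j) t^(-(j+1)), the derivative of the power cancels the term (j + 1) q_j, and
    only q_(j+1) survives. *)
Lemma q_div_rderive j t : (j.+1 < k)%N -> 0 < t ->
  is_rderive (fun s => q j s / s ^+ j) t (q j.+1 t / t ^+ j.+1).
Proof.
move=> jk1 t0; rewrite -quot_derE//.
apply: (is_rderive_eq_pos (f := fun s => s * q j s * (s ^+ j.+1)^-1)) => //.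
  by move=> s; exact: quotE.
apply: is_rderiveM; first by apply: mulX_q_rderive => //; exact: ltW.
by apply: is_derive_rderive; exact: is_derive_invX.
Qed.

Lemma q_div_derive j t : (j.+1 < k)%N -> 0 < t ->
  {for t, continuous (q j.+1)} ->
  is_derive t 1 (fun s => q j s / s ^+ j) (q j.+1 t / t ^+ j.+1).
Proof.
move=> jk1 t0 cq.
apply: (near_eq_is_derive (f := fun s => s * q j s * (s ^+ j.+1)^-1)).
  by apply: near_eq_pos => // s; exact: quotE.
have D := is_deriveM (mulX_q_derive jk1 t0 cq) (is_derive_invX j t0).
apply: (is_derive_eq D); rewrite -quot_derE// /GRing.scale /=; ring.
Qed.

Lemma derive1n_q i t : (i.+1 < k)%N -> 0 < t ->
  (q 0)^`(i) t = q i t / t ^+ i.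
Proof.
elim: i t => [|i IH] t ik t0; first by rewrite expr0 divr1.
rewrite derive1nS (@derive1_eq_pos _ _ (fun s => q i s / s ^+ i))//.
  by apply: is_derive_derive1; apply: q_div_derive; [exact: jk|done|exact: q_continuous].
by move=> s s0; apply: IH => //; exact: jk.
Qed.

Lemma derive1n_q_rderive i t : (i.+1 < k)%N -> 0 < t ->
  is_rderive ((q 0)^`(i)) t (q i.+1 t / t ^+ i.+1).
Proof.
move=> ik t0; apply: is_rderive_eq_pos (q_div_rderive ik t0) => //.
by move=> s s0; rewrite derive1n_q.
Qed.

Lemma derive1n_q_derivable i t : (i.+1 < k)%N -> 0 < t ->
  {for t, continuous (q i.+1)} -> derivable ((q 0)^`(i)) t 1.
Proof.
move=> ik t0 cq.
apply: (@derivable_eq_pos _ (fun s => q i s / s ^+ i)) => //.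
  by move=> s s0; rewrite derive1n_q.
by have [] := q_div_derive ik t0 cq.
Qed.

(** For j >= 1 and t = 0 the factor t^j gives 0 whatever value [deriveR] takes there, and [q_at0]
    gives the same on the right. *)
Lemma deriveR_q j t : (j < k)%N -> 0 <= t -> t ^+ j * deriveR j (q 0) t = q j t.
Proof.
case: j => [|j] jk1 t0; first by rewrite expr0 mul1r.
move: t0; rewrite le_eqVlt => /predU1P[<-|t0].
  by rewrite expr0n mul0r q_at0.
rewrite /= (is_rderive_val (derive1n_q_rderive jk1 t0)).
by rewrite mulrC divfK// expf_neq0// gt_eqF.
Qed.

(* [(t^n p)^(j) = t^(n-j) sum_i coef n j i q_i]. *)
Fixpoint coef (n j i : nat) : nat :=
  if j is j'.+1 then
    ((n - j' + i) * coef n j' i + (if i is i'.+1 then coef n j' i' else 0))%N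
  else (i == 0)%N.

Lemma coef_eq0 n j i : (j < i)%N -> coef n j i = 0%N.
Proof.
elim: j i => [|j IH] [|i]//= ji.
by rewrite (IH i.+1) ?(ltnW ji)// muln0 add0n IH.
Qed.

(** The recursion of [coef] mirrors the derivative of t^(n-j) q_i, which is t^(n-j-1) ((n - j + i)
    q_i + q_(i+1)) for j < n; here the terms are regrouped by index. *)
Lemma coef_sum n j (a : nat -> R) :
  \sum_(i < j.+2) (coef n j.+1 i)%:R * a i =
  \sum_(i < j.+1) (coef n j i)%:R * ((n - j + i)%:R * a i + a i.+1).
Proof.
under eq_bigr do rewrite /= natrD natrM mulrDl.
rewrite big_split /= big_ord_recr /= coef_eq0// mulr0 mul0r addr0.
rewrite [X in _ + X]big_ord_recl /= mul0r add0r -big_split /=.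
by apply: eq_bigr => i _; rewrite mulrDr mulrA [_%:R * _%:R]mulrC.
Qed.

Let K := k.-1.

Definition xi_derive j t : R :=
  t ^+ (K - j) * \sum_(i < j.+1) (coef K j i)%:R * q i t.

Lemma xi_derive_is_derive j t : (j.+2 < k)%N -> 0 < t ->
  is_derive t 1 (xi_derive j) (xi_derive j.+1 t).
Proof.
move=> jk2 t0; pose M := (K - j.+1)%N.
have KM : (K - j = M.+1)%N by rewrite /M /K; lia.
have D1 : is_derive t 1 (fun s => \sum_(i < j.+1) (coef K j i)%:R * (s * q i s))
    (\sum_(i < j.+1) (coef K j i)%:R * (q i.+1 t + i.+1%:R * q i t)).
  have -> : (fun s => \sum_(i < j.+1) (coef K j i)%:R * (s * q i s)) =
      \sum_(i < j.+1) (fun s => (coef K j i)%:R * (s * q i s)).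
    by apply/funext => s; rewrite fct_sumE.
  apply: is_derive_sum => i; apply: is_deriveZ_fun.
  have ij := ltn_ord i.
  by apply: mulX_q_derive => //; [|apply: q_continuous => //]; lia.
(* One power of s is moved into the sum, because the ladder differentiates s q_i rather than q_i. *)
apply: (near_eq_is_derive
  (f := fun s => s ^+ M * \sum_(i < j.+1) (coef K j i)%:R * (s * q i s))).
  apply: near_eq_pos => // s s0; rewrite /xi_derive KM (exprSr s M).
  rewrite -[RHS]mulrA; congr (_ * _); rewrite big_distrr /=.
  by apply: eq_bigr => i _; rewrite mulrCA.
apply: (is_derive_eq (is_deriveM (is_derive_Xn M t) D1)).
rewrite /xi_derive -/M (coef_sum K j (fun i => q i t)) KM /GRing.scale /=.
have -> : (\sum_(i < j.+1) (coef K j i)%:R * (t * q i t)) * (M%:R * t ^+ M.-1) =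
    t ^+ M * \sum_(i < j.+1) (coef K j i)%:R * (M%:R * q i t).
  rewrite big_distrl big_distrr /=; apply: eq_bigr => i _.
  by case: (M) => [|m] /=; rewrite ?exprS; ring.
rewrite -mulrDr -big_split /=; congr (_ * _); apply: eq_bigr => i _.
rewrite -mulrDr; congr (_ * _).
by rewrite -!natr1 natrD; ring.
Qed.

Lemma xi_derive_at0 j : (j.+1 < k)%N -> xi_derive j 0 = 0.
Proof.
by move=> jk1; rewrite /xi_derive expr0n (_ : (K - j == 0)%N = false) ?mul0r// /K; lia.
Qed.

Lemma xi_derive_is_rderive0 j : (j.+2 < k)%N ->
  is_rderive (xi_derive j) 0 (xi_derive j.+1 0).
Proof.
move=> jk2; rewrite xi_derive_at0//; pose M := (K - j.+2)%N.
(* The exponent is at least 2, so a factor h remains after division by h, and it multiplies a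
   quantity with a finite limit. *)
have KM : (K - j = M.+2)%N by rewrite /M /K; lia.
have C : h * (h ^+ M * \sum_(i < j.+1) (coef K j i)%:R * q i h) @[h --> 0^'+]
    --> 0 * (0 ^+ M * \sum_(i < j.+1) (coef K j i)%:R * q i 0).
  apply: cvgM; first by apply: cvg_at_right_filter; exact: cvg_id.
  apply: cvgM.
    by apply: cvg_at_right_filter; exact: exprn_continuous.
  apply: cvg_big => [|i _]; first exact: add_continuous.
  apply: cvgM; first exact: cvg_cst.
  by apply: rcq; have := ltn_ord i; lia.
move: C; rewrite mul0r; apply: cvg_trans; apply: near_eq_cvg; near=> h.
have h0 : 0 < h by [].
rewrite add0r (xi_derive_at0 (jk jk2)) subr0 /xi_derive KM !exprS -!mulrA.
by rewrite mulKf ?gt_eqF.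
Unshelve. all: by end_near. Qed.

Lemma xi_derive_half j (f : R -> R) t : (j.+2 < k)%N ->
  (forall s, 0 <= s -> f s = xi_derive j s) -> 0 <= t ->
  derivable_half f t /\ derive_half f t = xi_derive j.+1 t.
Proof.
move=> jk2 fE t0; rewrite /derivable_half /derive_half; case: ifPn => [t1|].
  have D := xi_derive_is_derive jk2 t1; split.
    have [dx _] := D.
    by apply: (derivable_eq_pos _ t1 dx) => s s0; rewrite fE// ltW.
  rewrite (@derive1_eq_pos _ _ (xi_derive j))//; first exact: is_derive_derive1.
  by move=> s s0; rewrite fE// ltW.
rewrite -leNgt => t1; have -> : t = 0 by apply/eqP; rewrite eq_le t1 t0.
have D : is_rderive f 0 (xi_derive j.+1 0).
  apply: cvg_trans (xi_derive_is_rderive0 jk2); apply: near_eq_cvg; near=> h.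
  have h0 : 0 <= h by apply/ltW.
  by rewrite !fE// addr_ge0.
by split; [exact: is_rderive_derivable D|exact: is_rderive_val].
Unshelve. all: by end_near. Qed.

Lemma xi_deriveE j t : (j.+1 < k)%N -> 0 <= t ->
  iter j (@derive_half R) (fun s => s ^+ K * q 0 s) t = xi_derive j t.
Proof.
elim: j t => [|j IH] t jk1 t0.
  by rewrite /xi_derive big_ord1 /= mul1r subn0.
rewrite iterS; apply: (xi_derive_half jk1 _ t0).2 => s s0.
by apply: IH => //; exact: jk.
Qed.

(** At order k - 2 the prefactor is t itself, so [q_step] writes every t q_i as an integral, with no
    further differentiation; [coef_sum] collects the integrands into a combination of q_0, ...,
    q_(k-1). *)
Lemma xi_derive_last m t : k = m.+2 -> 0 <= t ->
  ((xi_derive m t)%:E = \int[leb]_(s in `[0%R, t])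
    (\sum_(i < k) (coef K k.-1 i)%:R * q i s)%:E)%E.
Proof.
move=> km t0; have Km : K = m.+1 by rewrite /K km.
rewrite (eq_integral (fun s : measurableTypeR R => \sum_(i < m.+1)
    (coef K m i)%:R%:E * (q i.+1 s + i.+1%:R * q i s)%:E)%E); last first.
  move=> s _; rewrite km /= (coef_sum K m (fun i => q i s)) -sumEFin.
  apply: eq_bigr => i _; rewrite EFinM addrC; congr (_ * (_ + _ * _)%:E)%E.
  by rewrite Km subSnn add1n.
have ik (i : 'I_m.+1) : (i.+1 < k)%N by rewrite km ltnS.
have mI : measurable (`[0%R, t]%classic : set (measurableTypeR R)).
  exact: measurable_itv.
have mr (i : 'I_m.+1) : measurable_fun (`[0%R, t]%classic : set (measurableTypeR R))
    (fun s => (q i.+1 s + i.+1%:R * q i s)%:E).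
  apply/measurable_EFinP; apply: nondecreasing_measurable => //.
  exact: (ndr (ik i)).
rewrite ge0_integral_sum//; last 2 first.
- by move=> i; apply: measurable_funeM; exact: mr.
- move=> i s _; rewrite -EFinM lee_fin mulr_ge0//; exact: (r_ge0 s (ik i)).
rewrite /xi_derive Km subSnn expr1 big_distrr /= -sumEFin; apply: eq_bigr => i _.
rewrite ge0_integralZl_EFin//; last first.
  move=> s _; rewrite lee_fin; exact: (r_ge0 s (ik i)).
by rewrite -q_step// -EFinM mulrCA.
Qed.

End ladder.

(** * Representing measures *)

Section distr.
Context {R : realType}.
Local Notation leb := (@lebesgue_measure R).
Local Notation D := (`[0%R, +oo[%classic : set (measurableTypeR R)).
Variable m : {sigma_finite_measure set (measurableTypeR R) -> \bar R}.
Hypothesis mfin : forall x, 0 < x ->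
  (\int[m]_(s in `[0%R, +oo[) (expR (- (x * s)))%:E < +oo)%E.
Implicit Types s t x : R.

Definition distr t : R := fine (m `[0%R, t]%classic).

Lemma weight_ok1 : weight_ok m (fun=> 1).
Proof.
split=> // x x0; apply: le_lt_trans (mfin x0).
by rewrite le_eqVlt; apply/orP; left; apply/eqP; apply: eq_integral => t _; rewrite mulr1.
Qed.

Let mI t : measurable (`[0%R, t]%classic : set (measurableTypeR R)).
Proof. exact: measurable_itv. Qed.

Lemma distr_lty t : (m `[0%R, t]%classic < +oo)%E.
Proof.
by have := head_lty t weight_ok1; rewrite integral_cst// mul1e.
Qed.

Lemma distrE t : ((distr t)%:E = m `[0%R, t]%classic)%E.
Proof. by rewrite /distr fineK// ge0_fin_numE// distr_lty. Qed.

Lemma distr_ge0 t : 0 <= distr t.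
Proof. exact: fine_ge0. Qed.

Lemma distr_nd : {homo distr : s t / s <= t}.
Proof.
move=> s t st; rewrite -lee_fin !distrE; apply: le_measure; rewrite ?inE//.
by move=> x /=; rewrite !in_itv/= => /andP[-> /le_trans]; apply.
Qed.

Lemma distr_rc t : distr x @[x --> t^'+] --> distr t.
Proof.
pose F n : set (measurableTypeR R) := `[0%R, t + n.+1%:R^-1]%classic.
have FE : `[0%R, t]%classic = \bigcap_n F n.
  apply/seteqP; split => x; rewrite /F/= in_itv/=.
    move=> /andP[x0 xt] n _; rewrite /= in_itv/= x0 (le_trans xt)//.
    by rewrite lerDl invr_ge0.
  move=> xF; have := xF 0%N I; rewrite /= in_itv/= => /andP[-> _] /=.
  rewrite leNgt; apply/negP => tx.
  have := xF (Num.truncn (x - t)^-1) I; rewrite /= in_itv/= => /andP[_].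
  rewrite leNgt => /negP; apply.
  rewrite -ltrBrDl -[ltRHS]invrK ltf_pV2 ?posrE ?invr_gt0 ?subr_gt0//.
  exact: truncnS_gt.
have C : m (F n) @[n --> \oo] --> m `[0%R, t]%classic.
  rewrite FE; apply: nonincreasing_cvg_mu.
  - exact: distr_lty.
  - by move=> n; exact: mI.
  - by rewrite -FE; exact: mI.
  - move=> n p np; apply/subsetPset => x; rewrite /F/= !in_itv/= => /andP[-> /=].
    by move=> /le_trans; apply; rewrite lerD2l lef_pV2 ?posrE// ler_nat ltnS.
apply/cvgrPdist_lt => e e0.
have [n nP] : exists n, distr (t + n.+1%:R^-1) < distr t + e.
  have {}C : distr (t + n.+1%:R^-1) @[n --> \oo] --> distr t.
    by apply: fine_cvg; rewrite distrE.
  have [n _ nP] := cvgr_lt (distr t) C (distr t + e) (ltr_pwDr e0 (lexx _)).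
  by exists n; exact: nP n (leqnn n).
near=> x; rewrite distrC ger0_norm ?subr_ge0 ?distr_nd//.
rewrite ltrBlDl; apply: le_lt_trans nP; apply: distr_nd.
by near: x; apply: nbhs_right_le; rewrite ltrDl invr_gt0.
Unshelve. all: by end_near. Qed.

Lemma distr_continuous t : 0 < t -> m [set t] = 0%E -> {for t, continuous distr}.
Proof.
move=> t0 mt; apply/left_right_continuousP; split; last exact: distr_rc.
pose T n := t - t / n.+1%:R.
pose F n : set (measurableTypeR R) := `[0%R, T n]%classic.
have FE : `[0%R, t[%classic = \bigcup_n F n.
  apply/seteqP; split => x; rewrite /F/= in_itv/=.
    move=> /andP[x0 xt]; exists (Num.truncn (t / (t - x))) => //=.
    rewrite in_itv/= x0/= lerBrDl -lerBrDr.
    rewrite ler_pdivrMr// mulrC -ler_pdivrMr ?subr_gt0//.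
    exact: ltW (truncnS_gt _).
  move=> [n _]; rewrite /= in_itv/= => /andP[-> /= /le_lt_trans]; apply.
  by rewrite ltrBlDr ltrDl divr_gt0.
have Ft : m `[0%R, t[%classic = m `[0%R, t]%classic.
  have -> : `[0%R, t]%classic = `[0%R, t[%classic `|` [set t].
    by rewrite setUitv1// bnd_simp ltW.
  rewrite measureU//; first by rewrite [X in (_ = _ + X)%E](_ : _ = 0%E) ?adde0//; exact: mt.
  by rewrite -subset0 => x /= [+ xt]; rewrite xt in_itv/= ltxx andbF.
have C : m (F n) @[n --> \oo] --> m `[0%R, t]%classic.
  rewrite -Ft FE; apply: nondecreasing_cvg_mu.
  - by move=> n; exact: mI.
  - by rewrite -FE; exact: measurable_itv.
  - move=> n p np; apply/subsetPset => x; rewrite /F/= !in_itv/= => /andP[-> /=].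
    move=> /le_trans; apply; rewrite lerD2l lerN2 ler_pM2l//.
    by rewrite lef_pV2 ?posrE// ler_nat ltnS.
apply/cvgrPdist_lt => e e0.
have [n nP] : exists n, distr t - e < distr (T n).
  have {}C : distr (T n) @[n --> \oo] --> distr t.
    by apply: fine_cvg; rewrite distrE.
  have te : distr t - e < distr t by rewrite ltrBlDr ltrDl.
  have [n _ nP] := cvgr_gt (distr t) C (distr t - e) te.
  by exists n; exact: nP n (leqnn n).
near=> x; have xt : x <= t by near: x; exact: nbhs_left_le.
rewrite ger0_norm ?subr_ge0 ?distr_nd// ltrBlDr -ltrBlDl.
apply: lt_le_trans nP _; apply: distr_nd.
by near: x; apply: nbhs_left_ge; rewrite ltrBlDr ltrDl divr_gt0.
Unshelve. all: by end_near. Qed.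

Lemma laplace_distr x : 0 < x ->
  (x%:E * \int[leb]_(t in `[0%R, +oo[) (expR (- (x * t)) * distr t)%:E =
   \int[m]_(s in `[0%R, +oo[) (expR (- (x * s)))%:E)%E.
Proof.
move=> x0.
rewrite -ge0_integralZl_EFin//=; last 3 first.
- by move=> t _; rewrite lee_fin mulr_ge0 ?expR_ge0 ?distr_ge0.
- apply/measurable_EFinP/measurable_funM; first exact: measurable_expRN.
  exact: nondecreasing_measurable distr_nd.
- exact: ltW.
transitivity (\int[leb]_(s in `[0%R, +oo[)
    ((x * expR (- (x * s)))%:E * m `[0%R, s]%classic))%E.
  by apply: eq_integral => t _; rewrite -distrE -!EFinM mulrA.
rewrite -(@layer_cake R m (fun s => x * expR (- (x * s)))).
- by apply: eq_integral => u _; rewrite integral_expR_tail.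
- by move=> s; rewrite mulr_ge0 ?expR_ge0// ltW.
- by apply/measurable_funM; [exact: measurable_cst|exact: measurable_expRN].
Qed.

(** Integration by parts: [layer_cake] with the indicator of s <= t evaluates the first integral as
    that of t - u, and adding u leaves the constant t. *)
Lemma integral_distr t : 0 <= t ->
  ((t * distr t)%:E = \int[leb]_(s in `[0%R, t]) (distr s)%:E +
                    \int[m]_(u in `[0%R, t]) u%:E)%E.
Proof.
move=> t0.
pose w s : R := (s <= t)%R%:R.
have mw : measurable_fun setT w.
  rewrite [X in measurable_fun _ X](_ : _ =
    \1_(`]-oo, t]%classic : set (measurableTypeR R))); first exact: measurable_indic.
  by apply/funext => s; rewrite indicE mem_setE in_itv.
have := @layer_cake R m w (fun s => ler0n _ _) mw.
have -> : (\int[leb]_(s in `[0%R, +oo[) ((w s)%:E * m `[0%R, s]%classic) =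
    \int[leb]_(s in `[0%R, t]) (distr s)%:E)%E.
  rewrite integral_mkcond [RHS]integral_mkcond; apply: eq_integral => s _.
  rewrite !patchE !mem_setE !in_itv/= andbT /w -distrE.
  by case: (0 <= s) => //=; case: (s <= t); rewrite ?mul1e ?mul0e.
move=> <-.
have -> : (\int[m]_(u in `[0%R, +oo[) \int[leb]_(s in `[u, +oo[) (w s)%:E =
    \int[m]_(u in `[0%R, t]) (t - u)%:E)%E.
  rewrite integral_mkcond [RHS]integral_mkcond; apply: eq_integral => u _.
  rewrite !patchE !mem_setE !in_itv/= andbT.
  have -> : (\int[leb]_(s in `[u, +oo[) (w s)%:E = \int[leb]_(s in `[u, t]) 1)%E.
    rewrite integral_mkcond [RHS]integral_mkcond; apply: eq_integral => s _.
    rewrite !patchE !mem_setE !in_itv/= andbT /w.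
    by case: (u <= s) => //=; case: (s <= t).
  rewrite integral_cst//= mul1e lebesgue_measure_itv/= lte_fin.
  case: (0 <= u) => //=; rewrite le_eqVlt; case: eqVneq => [->|_] /=.
    by rewrite ltxx subrr.
  by case: ltP.
have mid (A : set (measurableTypeR R)) : measurable_fun A (fun u : R => u%:E).
  exact/measurable_EFinP/measurable_id.
rewrite -ge0_integralD//; first last.
- by move=> u /=; rewrite in_itv/= lee_fin => /andP[].
- apply/measurable_EFinP/measurable_funB; first exact: measurable_cst.
  exact: measurable_id.
- by move=> u /=; rewrite in_itv/= lee_fin subr_ge0 => /andP[].
under eq_integral do rewrite -EFinD subrK.
by rewrite integral_cst// EFinM distrE.
Qed.

End distr.

(** * The measures attached to the signed derivatives *)

Section representing_measures.
Context {R : realType}.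
Local Notation leb := (@lebesgue_measure R).
Local Notation D := (`[0%R, +oo[%classic : set (measurableTypeR R)).
Variables (f : R -> R) (k : nat).
Hypothesis hf : forall j, (j <= k)%N -> completely_monotonic (signed_derive j f).

Let smooth_f : smooth_pos f.
Proof.
have [s _] := hf (leq0n k); apply: smooth_eq_pos s => y _.
by rewrite /signed_derive expr0 mul1r derive1n0 expr0 mul1r.
Qed.

Lemma representing_measures :
  exists m : nat -> {sigma_finite_measure set (measurableTypeR R) -> \bar R},
  [/\ forall j, m j `]-oo, 0[%classic = 0%E,
      forall j x, (j < k)%N -> 0 < x ->
        (\int[m j]_(s in `[0%R, +oo[) (expR (- (x * s)))%:E =
         (x * signed_derive j f x)%:E)%E &
      forall x, 0 < x ->
        (\int[m k]_(s in `[0%R, +oo[) (expR (- (x * s)))%:E =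
         (signed_derive k f x)%:E)%E].
Proof.
(* Beyond k the family is continued by h_k, so that every index has a completely monotonic function
   and choice applies over all of [nat]. *)
pose g j := if (j < k)%N then (fun x => x * signed_derive j f x)
  else signed_derive k f.
have cm_g j : completely_monotonic (g j).
  rewrite /g; case: ifPn => [jk|_]; last exact: hf.
  by apply: (cm_mulX_signed_derive smooth_f _ _).2; apply: hf => //; exact: ltnW.
have [m mP] := choice (fun j => bernstein (cm_g j)).
exists m; split=> [j|j x jk x0|x x0]; first exact: (mP j).1.
  by rewrite (mP j).2// /g jk.
by rewrite (mP k).2// /g ltnn.
Qed.

Variable m : nat -> {sigma_finite_measure set (measurableTypeR R) -> \bar R}.
Hypothesis m_laplace : forall j x, (j < k)%N -> 0 < x ->
  (\int[m j]_(s in `[0%R, +oo[) (expR (- (x * s)))%:E =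
   (x * signed_derive j f x)%:E)%E.
Hypothesis mk_laplace : forall x, 0 < x ->
  (\int[m k]_(s in `[0%R, +oo[) (expR (- (x * s)))%:E =
   (signed_derive k f x)%:E)%E.

Let q j := distr (m j).

Lemma m_lty j x : (j <= k)%N -> 0 < x ->
  (\int[m j]_(s in `[0%R, +oo[) (expR (- (x * s)))%:E < +oo)%E.
Proof.
rewrite leq_eqVlt => /predU1P[->|jk] x0; first by rewrite mk_laplace// ltry.
by rewrite m_laplace// ltry.
Qed.

Let m_lty' j : (j < k)%N -> forall x, 0 < x ->
  (\int[m j]_(s in `[0%R, +oo[) (expR (- (x * s)))%:E < +oo)%E.
Proof. by move=> /ltnW jk x; exact: m_lty. Qed.

Lemma laplace_q j x : (j < k)%N -> 0 < x ->
  (\int[leb]_(t in `[0%R, +oo[) (expR (- (x * t)) * q j t)%:E =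
   (signed_derive j f x)%:E)%E.
Proof.
move=> jk x0; have := laplace_distr (m_lty' jk) x0; rewrite m_laplace// => E.
have x1 : x^-1 * x = 1 by rewrite mulVf// gt_eqF.
rewrite -[LHS]mul1e -[1%E]/(1%:E) -x1 EFinM -muleA E -EFinM.
by rewrite mulrA x1 mul1r.
Qed.

Lemma weight_ok_id j : (j < k)%N -> weight_ok (m j) id.
Proof.
move=> jk; split=> // x x0.
by rewrite (laplace_derive1 (fun y => m_laplace jk (x := y)))// ltry.
Qed.

Lemma weight_ok_q (j : nat) (c : R) : (j < k)%N -> 0 <= c ->
  weight_ok leb (fun t => c * q j t) /\
  forall x, 0 < x -> wint leb (fun t => c * q j t) (fun t => expR (- (x * t))) =
    (c * signed_derive j f x)%:E.
Proof.
move=> jk c0; have mq := nondecreasing_measurable (D := D) (measurable_itv _)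
  (distr_nd (m_lty' jk)).
have E x : 0 < x -> wint leb (fun t => c * q j t) (fun t => expR (- (x * t))) =
    (c * signed_derive j f x)%:E.
  move=> x0; rewrite EFinM -laplace_q// -ge0_integralZl_EFin//.
  - by apply: eq_integral => t _; rewrite -EFinM mulrCA.
  - by move=> t _; rewrite lee_fin mulr_ge0 ?expR_ge0 ?distr_ge0.
  - by apply/measurable_EFinP/measurable_funM => //; exact: measurable_expRN.
split=> //; split=> [t _||x x0].
- by rewrite mulr_ge0// distr_ge0.
- by apply: measurable_funM => //; exact: measurable_cst.
- by rewrite E// ltry.
Qed.

Let laplace_id j x : (j < k)%N -> 0 < x ->
  wint (m j) id (fun t => expR (- (x * t))) =
  ((signed_derive j.+1 f x)%:E + (j%:R * signed_derive j f x)%:E)%E.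
Proof.
move=> jk x0; rewrite (laplace_derive1 (fun y => m_laplace jk (x := y)))//.
have [D1 _] := cm_mulX_signed_derive smooth_f (hf (ltnW jk)) (hf jk).
by rewrite (D1 x x0) opprK EFinD.
Qed.

Lemma measure_step j (B : set (measurableTypeR R)) : (j.+1 < k)%N ->
  measurable B -> B `<=` `[0%R, +oo[ ->
  (\int[m j]_(t in B) t%:E = \int[leb]_(t in B) (q j.+1 t)%:E +
   \int[leb]_(t in B) (j%:R * q j t)%:E)%E.
Proof.
move=> jk1 mB BD; have jk := ltnW jk1.
have [ok2 E2] := weight_ok_q jk1 (@ler01 R).
have [ok3 E3] := weight_ok_q jk (ler0n R j).
rewrite (laplace_unique (weight_ok_id jk) ok2 ok3)//.
  by congr (_ + _)%E; apply: eq_integral => t _; rewrite mul1r.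
by move=> x x0; rewrite laplace_id// E2// E3// mul1r.
Qed.

Lemma measure_last j (B : set (measurableTypeR R)) : k = j.+1 ->
  measurable B -> B `<=` `[0%R, +oo[ ->
  (\int[m j]_(t in B) t%:E = m k B +
   \int[leb]_(t in B) (j%:R * q j t)%:E)%E.
Proof.
move=> kj mB BD; have jk : (j < k)%N by rewrite kj.
have [ok3 E3] := weight_ok_q jk (ler0n R j).
rewrite (laplace_unique (weight_ok_id jk)
  (weight_ok1 (fun x => m_lty (leqnn k) (x := x))) ok3)//.
  by rewrite integral_cst// mul1e.
move=> x x0; rewrite laplace_id// E3// -kj -mk_laplace//.
by congr (_ + _)%E; apply: eq_integral => t _; rewrite mulr1.
Qed.

(** Integration by parts contributes one more integral of q_j, which raises the coefficient j of
    [measure_step] to j + 1. *)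
Lemma q_step_integral j t : (j.+1 < k)%N -> 0 <= t ->
  ((t * q j t)%:E =
   \int[leb]_(s in `[0%R, t]) (q j.+1 s + j.+1%:R * q j s)%:E)%E.
Proof.
move=> jk1 t0; have jk := ltnW jk1.
have mI : measurable (`[0%R, t]%classic : set (measurableTypeR R)).
  exact: measurable_itv.
have mq i : (i < k)%N -> measurable_fun (`[0%R, t]%classic : set (measurableTypeR R)) (q i).
  by move=> ik; apply: nondecreasing_measurable => //; exact: distr_nd (m_lty' ik).
rewrite (integral_distr (m_lty' jk) t0) measure_step//; last first.
  by move=> s /=; rewrite !in_itv/= andbT => /andP[].
have q0 i s : 0 <= q i s by exact: distr_ge0.
have mEq i : (i < k)%N ->
    measurable_fun (`[0%R, t]%classic : set (measurableTypeR R)) (fun s => (q i s)%:E).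
  by move=> ik; apply/measurable_EFinP; exact: mq.
have mEjq : measurable_fun (`[0%R, t]%classic : set (measurableTypeR R))
    (fun s => (j%:R * q j s)%:E).
  by apply/measurable_EFinP/measurable_funM; [exact: measurable_cst|exact: mq].
rewrite -ge0_integralD//; last 3 first.
- by move=> s _; rewrite lee_fin.
- exact: mEq.
- by move=> s _; rewrite lee_fin mulr_ge0.
rewrite -ge0_integralD//; last 4 first.
- by move=> s _; rewrite lee_fin; exact: q0.
- by apply: mEq.
- by move=> s _; rewrite -EFinD lee_fin addr_ge0 ?mulr_ge0.
- by apply: emeasurable_funD => //; exact: mEq.
apply: eq_integral => s _; rewrite -!EFinD; congr EFin.
rewrite /q -natr1; ring.
Qed.

Lemma measure_last_itv (M : R) (B : set (measurableTypeR R)) : (0 < k)%N ->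
  measurable B -> B `<=` `[0%R, M] ->
  (m k B = \int[m k.-1]_(t in B) t%:E -
    (k.-1)%:R%:E * \int[leb]_(t in B) m k.-1 `[0%R, t]%classic)%E.
Proof.
move=> k0 mB BM; have kj : k = k.-1.+1 by rewrite prednK.
have jk : (k.-1 < k)%N by rewrite {2}kj.
have BD : B `<=` `[0%R, +oo[.
  by move=> t /BM /=; rewrite !in_itv/= andbT => /andP[].
have q0 s : 0 <= q k.-1 s by exact: distr_ge0.
have mq (A : set (measurableTypeR R)) : measurable A ->
    measurable_fun A (fun s => (q k.-1 s)%:E).
  move=> mA; apply/measurable_EFinP; apply: nondecreasing_measurable => //.
  exact: distr_nd (m_lty' jk).
have -> : (\int[leb]_(t in B) m k.-1 `[0%R, t]%classic =
    \int[leb]_(t in B) (q k.-1 t)%:E)%E.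
  by apply: eq_integral => t _; rewrite -(distrE (m_lty' jk)).
rewrite (measure_last kj mB BD) -ge0_integralZl_EFin//; last 2 first.
- by move=> t _; rewrite lee_fin.
- exact: mq.
(* Boundedness of B enters here: the subtracted term is at most an integral over [0, M], which is
   finite. *)
rewrite addeK//; rewrite ge0_fin_numE; last first.
  by apply: integral_ge0 => t _; rewrite lee_fin mulr_ge0.
have [ok3 _] := weight_ok_q jk (ler0n R k.-1).
apply: le_lt_trans (head_lty M ok3).
apply: ge0_subset_integral => //.
- apply/measurable_EFinP/measurable_funM; first exact: measurable_cst.
  by apply/measurable_EFinP; exact: mq.
- by move=> t _; rewrite lee_fin mulr_ge0.
Qed.

End representing_measures.

(** * Combinations of measures, and proof of the theorem *)

Section combination.
Context {R : realType}.
Variables (k : nat) (c : nat -> nat).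
Variable m : nat -> {measure set (measurableTypeR R) -> \bar R}.

Definition mcomb : {measure set (measurableTypeR R) -> \bar R} :=
  msum (fun i => mscale (NngNum (ler0n R (c i))) (m i)) k.

Lemma mcombE A : (mcomb A = \sum_(i < k) (c i)%:R%:E * m i A)%E.
Proof. by []. Qed.

Lemma classA0_mcomb : (forall i, (i < k)%N -> classA0 (m i)) -> classA0 mcomb.
Proof.
move=> mA; split=> [|x x0].
  rewrite mcombE big1// => i _; rewrite (_ : m i _ = 0%E) ?mule0//.
  exact: (mA i (ltn_ord i)).1.
have me : measurable_fun (`[0%R, +oo[%classic : set (measurableTypeR R))
    (fun s => (expR (- (x * s)))%:E).
  by apply/measurable_EFinP; exact: measurable_expRN.
have mD : measurable (`[0%R, +oo[%classic : set (measurableTypeR R)).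
  exact: measurable_itv.
rewrite ge0_integral_measure_sum//.
apply: lte_sum_pinfty => i _; rewrite ge0_integral_mscale//.
rewrite lte_mul_pinfty ?lee_fin//; exact: (mA i (ltn_ord i)).2.
Qed.

End combination.

Theorem theorem1p3 (R : realType) (f : R -> R) (k : nat) (hk : (1 <= k)%N)
    (hf : forall j : nat, (j <= k)%N ->
       completely_monotonic (signed_derive j f)) :
  exists (p : R -> R) (sigma : {measure set (measurableTypeR R) -> \bar R})
         (sigma_ : nat -> {measure set (measurableTypeR R) -> \bar R}),
    (* f is the Laplace transform of p *)
    (forall x : R, 0 < x ->
       (f x)%:E =
       (\int[lebesgue_measure]_(t in `[0%R, +oo[) (expR (- (x * t)) * p t)%:E)%E)
    /\
    (* t^(k-1) p(t) is in A_k(sigma) *)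
    classA k sigma (fun t => t ^+ k.-1 * p t)
    /\
    (* p has derivatives up to order k-1 on (0, oo); the one of order k-1 is
       one-sided at the atoms of sigma_(k-1) *)
    (forall (i : nat) (t : R), (i.+1 < k)%N -> 0 < t ->
       derivable_right (derive1n i p) t /\
       ((i.+2 < k)%N \/ sigma_ i.+1 [set t] = 0%E -> derivable (derive1n i p) t 1))
    /\
    (* t^j p^(j)(t) is in A_1(sigma_j) for j <= k-1 *)
    (forall j : nat, (j < k)%N ->
       classA1 (sigma_ j) (fun t => t ^+ j * deriveR j p t))
    /\
    (* d sigma_k = t d sigma_(k-1) - (k-1) sigma_(k-1)([0,t]) dt is a positive
       measure; both terms are finite on bounded Borel subsets of [0, oo) *)
    (forall (M : R) (B : set (measurableTypeR R)),
       measurable B -> B `<=` `[0, M] ->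
       sigma_ k B =
       (\int[sigma_ k.-1]_(t in B) t%:E
        - (k.-1)%:R%:E
          * \int[lebesgue_measure]_(t in B) sigma_ k.-1 `[0%R, t]%classic)%E)
    /\
    (forall (j : nat) (x : R), (j < k)%N -> 0 < x ->
       (signed_derive j f x)%:E =
       (\int[lebesgue_measure]_(t in `[0%R, +oo[)
          (expR (- (x * t)) * (t ^+ j * deriveR j p t))%:E)%E)
    /\
    (forall x : R, 0 < x ->
       (signed_derive k f x)%:E =
       (\int[sigma_ k]_(t in `[0%R, +oo[) (expR (- (x * t)))%:E)%E).
Proof.
have [m [mneg mL mkL]] := representing_measures hf.
pose q j := distr (m j).
have m_fin j : (j < k)%N -> forall x, 0 < x ->
    (\int[m j]_(s in `[0%R, +oo[) (expR (- (x * s)))%:E < +oo)%E.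
  by move=> jk x x0; rewrite mL// ltry.
have qE j t : (j < k)%N -> (q j t)%:E = m j `[0, t]%classic.
  by move=> jk; exact: distrE (m_fin j jk) t.
have ndq j : (j < k)%N -> {homo q j : s t / s <= t}.
  by move=> jk; exact: distr_nd (m_fin j jk).
have rcq j t : (j < k)%N -> q j x @[x --> t^'+] --> q j t.
  by move=> jk; exact: distr_rc (m_fin j jk) t.
have q_ge0 j t : (j < k)%N -> 0 <= q j t by move=> _; exact: distr_ge0.
have q_step j t : (j.+1 < k)%N -> 0 <= t -> ((t * q j t)%:E =
    \int[lebesgue_measure]_(s in `[0%R, t]) (q j.+1 s + j.+1%:R * q j s)%:E)%E.
  exact: (q_step_integral hf mL mkL).
have mA0 j : (j < k)%N -> classA0 (m j).
  by move=> jk; split; [exact: mneg|exact: m_fin].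
have dR j t : (j < k)%N -> 0 <= t -> t ^+ j * deriveR j (q 0%N) t = q j t.
  exact: (deriveR_q ndq rcq q_ge0 q_step).
(* The coefficients of the formal derivative of order k - 1 of t^(k-1) p, whose prefactor is t^0.
   Being natural numbers, they make sigma a positive measure, with that combination of the q_i as
   distribution function. *)
pose c := coef k.-1 k.-1.
pose sigma := mcomb k c (fun i => m i).
have sA0 : classA0 sigma by exact: classA0_mcomb.
have sE t : (\sum_(i < k) (c i)%:R * q i t)%:E = sigma `[0, t]%classic.
  rewrite /sigma mcombE -sumEFin; apply: eq_bigr => i _.
  by rewrite EFinM qE.
exists (q 0%N), sigma, (fun j => m j).
have hj j x : (j < k)%N -> 0 < x -> (signed_derive j f x)%:E =
   (\int[lebesgue_measure]_(t in `[0%R, +oo[)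
      (expR (- (x * t)) * (t ^+ j * deriveR j (q 0%N) t))%:E)%E.
  move=> jk x0; rewrite -(laplace_q mL mkL jk x0); apply: eq_integral => t.
  by rewrite inE/= in_itv/= andbT => t0; rewrite dR.
split=> [x x0|].
  rewrite (laplace_q mL mkL hk x0).
  by rewrite /signed_derive expr0 mul1r derive1n0 expr0 mul1r.
split.
  have [k1|k2] := eqVneq k 1%N.
    rewrite [X in classA X]k1 /=; split=> [|t t0]; first exact: sA0.
    by rewrite -sE /c k1 big_ord1 /= expr0 !mul1r.
  have km : k = (k - 2).+2 by lia.
  rewrite [X in classA X]km /=; split=> // [j t jm t0|j jm|t t0].
  - have E := xi_deriveE ndq rcq q_ge0 q_step.
    apply: (xi_derive_half ndq rcq q_ge0 q_step _ _ t0).1 => [|s s0]; last first.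
      by apply: E => //; lia.
    by lia.
  - rewrite (xi_deriveE ndq rcq q_ge0 q_step)//; last by lia.
    by rewrite xi_derive_at0//; lia.
  - rewrite (xi_deriveE ndq rcq q_ge0 q_step)//; last by lia.
    rewrite (xi_derive_last ndq q_ge0 q_step km t0).
    by apply: eq_integral => s _; rewrite -sE.
split=> [i t ik t0|].
  split; first exact: is_rderive_derivable (derive1n_q_rderive ndq rcq q_ge0 q_step ik t0).
  move=> h; apply: (derive1n_q_derivable ndq q_ge0 q_step) => //.
  (* Below the top order q_(i+1) is continuous by the ladder; at the top order it is continuous at t
     because sigma_(i+1) has no atom there. *)
  case: h => [ik2|mt]; first exact: (q_continuous ndq q_ge0 q_step).
  exact: (distr_continuous (m_fin _ ik) t0 mt).
split=> [j jk|].
  split; first exact: mA0.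
  by move=> t t0; rewrite dR// qE.
split=> [M B mB BM|].
  exact: (measure_last_itv hf mL mkL hk mB BM).
split; first exact: hj.
by move=> x x0; rewrite mkL.
Qed.
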